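(* Let $X$ be the Chamanara surface and let $Y$ be a devious finite abelian cover of $X$. Then the Veech group $\Gamma(Y)$ has infinite index in the Veech group $\Gamma(X)$.
   Context: Chamanara surface: take the open unit square $(0,1)^2$ and, for each $n\ge 1$, add open boundary segments and glue them by translations: the left segment $\{0\}\times(1-2^{1-n},1-2^{-n})$ is glued to the right segment $\{1\}\times(2^{-n},2^{1-n})$; the bottom segment $(1-2^{1-n},1-2^{-n})\times\{0\}$ is glued to the top segment $(2^{-n},2^{1-n})\times\{1\}$. The result $X$ (endpoints of segments and corners not included) is a translation surface. For a translation surface $S$, $\Gamma(S)\subseteq\mathrm{SL}(2,\mathbb{R})$ is the group of all matrices of determinant $1$ that are derivatives of affine diffeomorphisms of $S$. Covering surfaces of $X$ carry the pulled-back translation structure; one has $\Gamma(Y)\subseteq\Gamma(X)$ for every connected cover $Y\to X$. A finite abelian cover is a connected normal covering with finite abelian deck group. Two translation surfaces are translation equivalent if there is a translation (homeomorphism that is a translation in charts) between them. $\mathrm{SL}_\pm(2,\mathbb{R})$ is the group of real $2\times2$ matrices of determinant $\pm1$, acting on translation surfaces by post-composition with charts. Put $g_t=\begin{pmatrix}e^t&0\\0&e^{-t}\end{pmatrix}$. Let $\mathcal{O}(X)=\{A\cdot X: A\in \mathrm{SL}_\pm(2,\mathbb{R})\}/\text{translation equivalence}$, with the topology of the quotient of $\mathrm{SL}_\pm(2,\mathbb{R})$ by the stabilizer of $X$. The Teichmüller orbit of $X$, $\{g_t\cdot X:t\in\mathbb{R}\}$, is non-divergent if there is a sequence $t_n\to\infty$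 such that $g_{t_n}\cdot X$ converges in $\mathcal{O}(X)$; this holds for the Chamanara surface. Fix $n\ge2$ and a subgroup $G$ of the symmetric group $S_n$ acting transitively on $\{1,\dots,n\}$. Let $\mathrm{Cov}^{\mathrm{HT}}_G(X)$ be the space of isomorphism classes of (possibly non-normal, possibly disconnected) degree-$n$ covers of $X$ given by monodromy homomorphisms $\pi_1(X)\to G\le S_n$, topologized as a quotient of $\mathrm{Hom}(\pi_1(X),G)$ with the topology of pointwise convergence ($G$ discrete). Let $$\widetilde{\mathcal{O}}_G(X)=\{A\cdot Z: A\in\mathrm{SL}_\pm(2,\mathbb{R}),\ Z\in\mathrm{Cov}^{\mathrm{HT}}_G(X)\}/\text{translation equivalence},$$ with the quotient topology induced from $\mathrm{SL}_\pm(2,\mathbb{R})\times\mathrm{Cov}^{\mathrm{HT}}_G(X)$; the group $\{g_t\}$ acts on it. A connected cover $Y\in\mathrm{Cov}^{\mathrm{HT}}_G(X)$ is devious if its Teichmüller orbit $\{g_t\cdot Y\}$ in $\widetilde{\mathcal{O}}_G(X)$ only accumulates on disconnected covers, i.e. every accumulation point of $g_t\cdot Y$ as $t\to\infty$ in $\widetilde{\mathcal{O}}_G(X)$ is represented by a disconnected cover. A devious finite abelian cover is a finite abelian cover that is devious for its deck group $G$, regarded as a transitive permutation group on the fibre. *)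

(* Defs.v *)
From HB Require Import structures.
From Stdlib Require Import Relation_Operators.
From mathcomp Require Import all_boot all_order all_algebra all_fingroup.
From mathcomp Require Import all_classical all_reals all_analysis.
From mathcomp Require Import lra.
Import Order.TTheory GRing.Theory Num.Theory.
Import numFieldNormedType.Exports.

Set Implicit Arguments.
Unset Strict Implicit.
Unset Printing Implicit Defensive.

Local Open Scope classical_set_scope.
Local Open Scope ring_scope.
Local Open Scope quotient_scope.

(* Quotients are taken by the generated equivalence.  Apart from the edge
   gluing, every relation used below is mathematically already an equivalence
   relation, so that nothing new is identified. *)
Section GeneratedEquivalence.
Context {T : choiceType} (r : T -> T -> Prop).

Definition gen_rel (x y : T) : bool := `[< clos_refl_sym_trans T r x y >].

Lemma gen_rel_refl : reflexive gen_rel.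
Proof. by move=> x; apply/asboolP; apply: rst_refl. Qed.

Lemma gen_rel_sym : symmetric gen_rel.
Proof.
by move=> x y; apply/idP/idP => /asboolP h; apply/asboolP; apply: rst_sym.
Qed.

Lemma gen_rel_trans : transitive gen_rel.
Proof.
move=> y x z /asboolP xy /asboolP yz; apply/asboolP.
exact: rst_trans xy yz.
Qed.

Canonical gen_equiv := EquivRel gen_rel gen_rel_refl gen_rel_sym gen_rel_trans.

Definition gen_quot := {eq_quot gen_equiv}.

Definition gen_class (x : T) : gen_quot := \pi_(gen_quot) x.

End GeneratedEquivalence.

Definition quot_space (T : topologicalType) (r : T -> T -> Prop) :
  topologicalType := quotient_topology (gen_quot r).

Definition quot_class {T : topologicalType} (r : T -> T -> Prop) (x : T) :
  quot_space r := gen_class r x.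

Definition homeomorphism {S T : topologicalType} (f : S -> T) : Prop :=
  continuous f /\
  exists g : T -> S, [/\ continuous g, cancel f g & cancel g f].

Section Covers.
Context {X : topologicalType}.

Definition covering_map {Y : topologicalType} (p : Y -> X) : Prop :=
  continuous p /\
  forall x : X, exists U : set X, [/\ open U, U x &
    exists F : set (set Y),
      [/\ forall V, F V -> open V,
          forall V W, F V -> F W -> V `&` W !=set0 -> V = W,
          p @^-1` U = \bigcup_(V in F) V &
          forall V, F V ->
            [/\ {in V &, injective p}, p @` V = U &
                forall W, open W -> W `<=` V -> open (p @` W)]]].

Definition cover_iso {Y Z : topologicalType} (p : Y -> X) (q : Z -> X) : Prop :=
  exists2 h : Y -> Z, homeomorphism h & q \o h = p.

Definition deck {Y : topologicalType} (p : Y -> X) : set (Y -> Y) :=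
  [set tau | homeomorphism tau /\ p \o tau = p].

Definition finite_abelian_cover {Y : topologicalType} (p : Y -> X) : Prop :=
  [/\ covering_map p,
      connected [set: Y],
      (forall y y', p y = p y' -> exists2 tau, deck p tau & tau y = y'),
      finite_set (deck p) &
      forall sigma tau, deck p sigma -> deck p tau ->
        sigma \o tau = tau \o sigma].

(* [G] is the deck group, as a permutation group of the fibre over [x0]; the
   fibre is numbered by [l]. *)
Definition deck_group_on_fibre {Y : topologicalType} (p : Y -> X) (x0 : X)
    (n : nat) (l : 'I_n -> Y) (G : {group 'S_n}) : Prop :=
  [/\ injective l, range l = p @^-1` [set x0] &
      forall s : 'S_n,
        s \in G <-> exists2 tau, deck p tau & forall i, tau (l i) = l (s i)].

End Covers.

(* A path is parametrized by [0,1]; its values outside [0,1] are irrelevant. *)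
Section Paths.
Context {R : realType} {X : topologicalType}.

Definition path_to (a b : X) : set (R -> X) :=
  [set c : R -> X | [/\ {within `[0, 1], continuous c}, c 0 = a & c 1 = b]].

Definition path_from (a : X) : set (R -> X) :=
  [set c : R -> X | {within `[0, 1], continuous c} /\ c 0 = a].

Definition concat (c d : R -> X) : R -> X :=
  fun t => if t <= 2^-1 then c (2 * t) else d (2 * t - 1).

Lemma within_comp_subset (A B : set R) (f : R -> R) (c : R -> X) :
  continuous f -> (forall t, A t -> B (f t)) -> {within B, continuous c} ->
  {within A, continuous (c \o f)}.
Proof.
move=> cf AB /subspace_continuousP cc; apply/subspace_continuousP => t At.
move=> V /(cc _ (AB t At)) /= cV.
have := cf t _ cV; rewrite /= /within /= !nbhs_simpl /=.
by apply: filterS => s /= sV As; apply: sV; exact: AB.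
Qed.

Lemma concat_path (a b e : X) (c d : R -> X) :
  path_to a b c -> path_to b e d -> path_to a e (concat c d).
Proof.
move=> [cc c0 c1] [cd d0 d1].
have cmul : continuous (fun t : R => 2 * t) by exact: mulrl_continuous.
have cmulB : continuous (fun t : R => 2 * t - 1).
  by move=> t; apply: continuousB; [exact: cmul | exact: cst_continuous].
split; last 2 first.
- by rewrite /concat invr_ge0 ler0n mulr0.
- rewrite /concat ifF; last by apply/negbTE; rewrite -ltNge; lra.
  by rewrite (_ : 2 * 1 - 1 = 1 :> R) //; lra.
have -> : `[0, 1]%classic = `[0, 2^-1] `|` `[2^-1, 1] :> set R.
  apply/seteqP; split => [t|t [|]] /=; rewrite !in_itv /=.
  - move=> /andP[t0 t1]; have [h|h] := leP t 2^-1; [left|right].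
      by rewrite t0.
    by rewrite t1 ltW.
  - by move=> ?; lra.
  - by move=> ?; lra.
apply: withinU_continuous; [exact: interval_closed | exact: interval_closed | |].
- apply: (@subspace_eq_continuous _ _ _ (c \o (fun t => 2 * t))).
    move=> t; rewrite inE /= in_itv /= => /andP[_ h].
    by rewrite /from_subspace /concat /= h.
  apply: (@within_comp_subset _ `[0, 1] _ c) => // t; rewrite /= !in_itv /= => ?; lra.
- apply: (@subspace_eq_continuous _ _ _ (d \o (fun t => 2 * t - 1))).
    move=> t; rewrite inE /= in_itv /= => /andP[t0 _]; rewrite /from_subspace /concat /=.
    case: ifPn => // t1; have -> : t = 2^-1 by apply/eqP; rewrite eq_le t1.
    by rewrite divff ?pnatr_eq0 // subrr d0 c1.
  apply: (@within_comp_subset _ `[0, 1] _ d) => // t; rewrite /= !in_itv /= => ?; lra.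
Qed.

Definition path_rev (c : R -> X) : R -> X := fun t => c (1 - t).

Definition homotopic (c d : R -> X) : Prop :=
  exists H : R * R -> X,
    [/\ {within `[0, 1] `*` `[0, 1], continuous H},
        forall t, 0 <= t <= 1 -> H (0, t) = c t /\ H (1, t) = d t &
        forall s, 0 <= s <= 1 -> H (s, 0) = c 0 /\ H (s, 1) = c 1].

End Paths.

Section FundamentalGroup.
Context (R : realType) {X : topologicalType} (x0 : X).

Definition loop : choiceType := set_type (@path_to R X x0 x0).

Lemma loop_concat_subproof (c d : loop) :
  concat (set_val c) (set_val d) \in @path_to R X x0 x0.
Proof. by apply/mem_set/concat_path; exact/set_mem/valP. Qed.

Definition loop_concat (c d : loop) : loop :=
  exist (fun e => e \in @path_to R X x0 x0) _ (loop_concat_subproof c d).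

Definition loop_homotopic (c d : loop) : Prop :=
  homotopic (set_val c) (set_val d).

Definition pi1 : choiceType := gen_quot loop_homotopic.

Definition pi1_class (c : loop) : pi1 := gen_class loop_homotopic c.

(* In mathcomp [(s * t) i = t (s i)], so that a homomorphism describes the
   right action of pi1 by lifting paths, [concat c d] running through c first. *)
Definition pi1_hom {gT : finGroupType} (rho : pi1 -> gT) : Prop :=
  forall c d : loop,
    rho (pi1_class (loop_concat c d))
      = (rho (pi1_class c) * rho (pi1_class d))%g.

Definition HomG_set (n : nat) (G : {group 'S_n}) :
    set {ptws pi1 -> discrete_topology 'S_n} :=
  [set rho | pi1_hom (gT := 'S_n) rho /\ forall a, (rho a : 'S_n) \in G].

Definition HomG (n : nat) (G : {group 'S_n}) : topologicalType :=
  set_type (HomG_set G).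

End FundamentalGroup.

(* The pair (c, i) stands for the endpoint of the lift of the path c that
   starts at the point number i of the fibre over [x0]. *)
Section MonodromyCover.
Context {R : realType} {X : topologicalType} {x0 : X} {n : nat}.
Context (rho : pi1 R x0 -> 'S_n).

Local Notation lift_pt := (set_type (@path_from R X x0) * 'I_n)%type.

Definition same_endpoint (a b : lift_pt) : Prop :=
  set_val a.1 1 = set_val b.1 1 /\
  exists2 e : loop R x0,
    set_val e = concat (set_val a.1) (path_rev (set_val b.1)) &
    rho (pi1_class e) a.2 = b.2.

Definition mcover := gen_quot same_endpoint.

Definition mcover_pt (a : lift_pt) : mcover := gen_class same_endpoint a.

(* V is open when, with the endpoint of the lift of c, it contains the
   endpoints of the lifts of all prolongations of c inside some neighbourhood
   of c 1. *)
Definition mcover_open (V : set mcover) : Prop :=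
  forall a : lift_pt, V (mcover_pt a) ->
    exists U : set X, [/\ open U, U (set_val a.1 1) &
      forall (d : R -> X) (b : lift_pt),
        path_from (set_val a.1 1) d -> d @` `[0, 1] `<=` U ->
        set_val b.1 = concat (set_val a.1) d -> b.2 = a.2 ->
        V (mcover_pt b)].

Lemma mcover_openT : mcover_open setT.
Proof. by move=> a _; exists setT; split => //; exact: openT. Qed.

Lemma mcover_openI (V W : set mcover) :
  mcover_open V -> mcover_open W -> mcover_open (V `&` W).
Proof.
move=> oV oW a [Va Wa].
have [U [oU Ua UV]] := oV a Va; have [U' [oU' Ua' UW]] := oW a Wa.
exists (U `&` U'); split => //; first exact: openI.
move=> d b pd dU eb eb2; split.
  by apply: (UV d b) => // x /dU [].
by apply: (UW d b) => // x /dU [].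
Qed.

Lemma mcover_open_bigcup (I : Type) (F : I -> set mcover) :
  (forall i, mcover_open (F i)) -> mcover_open (\bigcup_i F i).
Proof.
move=> oF a [i _ Fa]; have [U [oU Ua UF]] := oF i a Fa.
by exists U; split => // d b pd dU eb eb2; exists i => //; exact: (UF d b).
Qed.

HB.instance Definition _ := Choice.on mcover.
HB.instance Definition _ := isOpenTopological.Build mcover
  mcover_openT mcover_openI mcover_open_bigcup.

Definition mcover_proj (z : mcover) : X :=
  set_val (generic_quotient.repr (z : gen_quot same_endpoint)).1 1.

End MonodromyCover.

Arguments mcover_proj {R X x0 n} rho z.

Section Cov.
Context (R : realType) {X : topologicalType} (x0 : X) {n : nat}.
Context (G : {group 'S_n}).

Definition HomG_cover_iso (rho rho' : HomG R x0 G) : Prop :=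
  cover_iso (mcover_proj (set_val rho))
            (mcover_proj (set_val rho')).

Definition Cov : topologicalType := quot_space HomG_cover_iso.

Definition Cov_class (rho : HomG R x0 G) : Cov := quot_class HomG_cover_iso rho.

End Cov.

Section TranslationStructures.
Context {R : realType}.
Local Notation plane := 'cV[R]_2.

(* A translation structure is given by an atlas, a set of pairs (U, phi) where
   phi is only meaningful on U. *)
Definition atlas (S : topologicalType) := set (set S * (S -> plane)).

Definition is_chart {S : topologicalType} (U : set S) (phi : S -> plane) :=
  [/\ open U,
      {in U &, injective phi},
      forall W, open W -> open (U `&` phi @^-1` W) &
      forall W, open W -> W `<=` U -> open (phi @` W)].

Definition pullback {S T : topologicalType} (p : S -> T) (AT : atlas T) :
    atlas S :=
  [set c | is_chart c.1 c.2 /\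
     exists U phi, [/\ AT (U, phi), p @` c.1 `<=` U & c.2 = phi \o p]].

Definition mx_act {S : topologicalType} (A : 'M[R]_2) (AS : atlas S) :
    atlas S :=
  [set c | exists2 phi, AS (c.1, phi) & c.2 = (fun x => A *m phi x)].

Definition affine_homeo {S T : topologicalType} (AS : atlas S) (AT : atlas T)
    (A : 'M[R]_2) (f : S -> T) : Prop :=
  homeomorphism f /\
  forall x : S, exists U phi V psi,
    [/\ AS (U, phi), U x, AT (V, psi), V (f x) &
        exists b : plane, \forall y \near x, psi (f y) = A *m phi y + b].

Definition translation_equivalent {S T : topologicalType}
    (AS : atlas S) (AT : atlas T) : Prop :=
  exists f : S -> T, affine_homeo AS AT 1%:M f.

Definition veech {S : topologicalType} (AS : atlas S) : set 'M[R]_2 :=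
  [set A | \det A = 1 /\ exists f : S -> S, affine_homeo AS AS A f].

(* The left cosets of H by elements of K; meant for a subgroup H of K. *)
Definition infinite_index (H K : set 'M[R]_2) : Prop :=
  infinite_set [set C | exists2 A, K A & C = [set A *m B | B in H]].

Definition SLpm_set : set 'M[R]_2 := [set A | \det A = 1 \/ \det A = -1].

Definition g_mx (t : R) : 'M[R]_2 :=
  diag_mx (\row_(j < 2) if j == 0 then expR t else expR (- t)).

Lemma g_mx_SLpm (t : R) : g_mx t \in SLpm_set.
Proof.
rewrite inE; left.
by rewrite /g_mx det_diag big_ord_recl big_ord1 !mxE /= -expRD subrr expR0.
Qed.

End TranslationStructures.

Definition SLpm (R : realType) : topologicalType := set_type (@SLpm_set R).

Definition g_flow {R : realType} (t : R) : SLpm R :=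
  exist (fun A => A \in SLpm_set) (g_mx t) (g_mx_SLpm t).

Section Devious.
Context {R : realType} {X : topologicalType} (AX : @atlas R X) (x0 : X).

Definition mcover_atlas {n : nat} (rho : pi1 R x0 -> 'S_n) :
  atlas (mcover rho) := pullback (mcover_proj rho) AX.

Arguments mcover_atlas {n} rho.

Section OrbitSpace.
Context {n : nat} (G : {group 'S_n}).

Definition orbit_rel (a b : SLpm R * Cov R x0 G) : Prop :=
  exists rho rho' : HomG R x0 G,
    [/\ a.2 = Cov_class rho, b.2 = Cov_class rho' &
        translation_equivalent
          (mx_act (set_val a.1) (mcover_atlas (set_val rho)))
          (mx_act (set_val b.1) (mcover_atlas (set_val rho')))].

Definition orbit_space : topologicalType := quot_space orbit_rel.

Definition orbit_pt (A : SLpm R) (c : Cov R x0 G) : orbit_space :=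
  quot_class orbit_rel (A, c).

Definition devious {Y : topologicalType} (p : Y -> X) : Prop :=
  connected [set: Y] /\
  exists rho : HomG R x0 G,
    cover_iso p (mcover_proj (set_val rho)) /\
    forall z : orbit_space,
      cluster ((fun t : R => orbit_pt (g_flow t) (Cov_class rho)) @ +oo) z ->
      exists A (rho' : HomG R x0 G),
        z = orbit_pt A (Cov_class rho') /\
        ~ connected [set: mcover (set_val rho')].

End OrbitSpace.

Definition devious_finite_abelian_cover {Y : topologicalType} (p : Y -> X) :=
  finite_abelian_cover p /\
  exists n (l : 'I_n -> Y) (G : {group 'S_n}),
    [/\ (2 <= n)%N, deck_group_on_fibre p x0 l G & devious G p].

End Devious.

Section Chamanara.
Context (R : realType).
Local Notation plane := 'cV[R]_2.

Definition pt (x y : R) : plane := \col_(i < 2) if i == 0 then x else y.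

(* The segments number n = k + 1. *)
Definition low_seg (k : nat) (x : R) : bool := 1 - 2 ^- k < x < 1 - 2 ^- k.+1.
Definition high_seg (k : nat) (x : R) : bool := 2 ^- k.+1 < x < 2 ^- k.

(* The translation carrying low_seg k to high_seg k. *)
Definition seg_shift (k : nat) : R := 2 ^- k.+1 - (1 - 2 ^- k).

Definition square : set plane :=
  [set v | exists x y, v = pt x y /\
    [\/ 0 < x < 1 /\ 0 < y < 1,
        exists k, x = 0 /\ low_seg k y,
        exists k, x = 1 /\ high_seg k y |
        exists k, (low_seg k x /\ y = 0) \/ (high_seg k x /\ y = 1)]].

Definition glue (v w : set_type square) : Prop :=
  exists k,
    (exists2 y, low_seg k y &
       set_val v = pt 0 y /\ set_val w = pt 1 (y + seg_shift k)) \/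
    (exists2 x, low_seg k x &
       set_val v = pt x 0 /\ set_val w = pt (x + seg_shift k) 1).

Definition chamanara : topologicalType := quot_space glue.

Definition chamanara_pt (v : set_type square) : chamanara := quot_class glue v.

(* The charts which, read in the square, are locally translations; around a
   point of a glued edge this allows the two half-discs to be put together. *)
Definition chamanara_atlas : @atlas R chamanara :=
  [set c | is_chart c.1 c.2 /\
     forall v : set_type square, c.1 (chamanara_pt v) ->
       exists b : plane,
         \forall w \near v, c.2 (chamanara_pt w) = set_val w + b].

Lemma center_in_square : pt 2^-1 2^-1 \in square.
Proof.
rewrite inE; exists 2^-1, 2^-1; split => //; apply: Or41.
by split; rewrite invr_gt0 ltr0n /= invf_lt1 ?ltr0n // ltr1n.
Qed.

Definition chamanara_center : chamanara :=
  chamanara_pt (exist (fun v => v \in square) _ center_in_square).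

End Chamanara.

Arguments chamanara_atlas R : clear implicits.

(* Main.v *)
(** The baker map (x, y) |-> (2x, y/2 + 1/2) for x <= 1/2, (2x - 1, y/2) for
    x > 1/2, is an affine automorphism of the Chamanara surface X with
    derivative g_(ln 2), so the powers of g_(ln 2) lie in the Veech group of X.
    If two of them lay in the same coset of the Veech group of a cover Y, then
    that group would contain g_(-c) for some c > 0, and g_(kc) Y would be
    translation equivalent to Y for all k.  Hence Y itself would be an
    accumulation point of its Teichmueller orbit.  Translation equivalent covers
    are homeomorphic and Y is connected, so Y would not be devious. *)

Require Import Defs.
From Stdlib Require Import Relation_Operators.
From mathcomp Require Import all_boot all_order all_algebra all_fingroup.
From mathcomp Require Import all_classical all_reals all_analysis.
From mathcomp Require Import lra.
Import Order.TTheory GRing.Theory Num.Theory.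
Import numFieldNormedType.Exports.

Set Implicit Arguments.
Unset Strict Implicit.
Unset Printing Implicit Defensive.

Local Open Scope classical_set_scope.
Local Open Scope ring_scope.
Local Open Scope quotient_scope.

(** * Boundary segments and the plane *)

(** The atlas of X is given only through the quotient map, and the baker map cuts the square, so its
    affinity has to be checked across the glued edges and along the cut. A map [dev] from the plane
    to X, continued past the edges by folding, reduces this to identities
    [f (dev (v + t)) = dev (w + M *m t)] for small [t]; these compose by substitution and are
    translated into charts once. The inverse needs no case analysis of germs of its own: reflection
    in the diagonal is a symmetry of X that conjugates the baker map to its inverse. On the side of
    the covers, a point of the orbit space may be written with many different covers, so
    connectedness is followed along the chains that generate the equivalence. The coset argument
    uses no group law of the Veech group of Y: the identity lies in it, and comparing the powers in
    the right order yields the negative exponent directly. *)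

Section Segments.
Context {R : realType}.
Implicit Types (k j : nat) (x : R).

Lemma halfpow k : 0 < 2 ^- k :> R /\ 2 ^- k <= 1 :> R.
Proof. by rewrite invr_gt0 exprn_gt0 // invf_le1 ?exprn_gt0 // exprn_ege1 // ler1n. Qed.

Lemma halfpowS k : 2 ^- k.+1 = 2 ^- k / 2 :> R.
Proof. by rewrite exprSr invfM mulrC. Qed.

Lemma halfpow_le k j : (k < j)%N -> 2 ^- j <= 2 ^- k / 2 :> R.
Proof.
by move=> kj; rewrite -halfpowS lef_pV2 ?posrE ?exprn_gt0 // ler_weXn2l // ler1n.
Qed.

Lemma halfpow_gtS k j : 2 ^- k.+1 < 2 ^- j :> R -> (j <= k)%N.
Proof.
by move=> h; rewrite leqNgt; apply/negP => /halfpow_le; rewrite -halfpowS leNgt h.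
Qed.

Lemma low_seg_range k x : low_seg k x -> 0 < x < 1.
Proof. rewrite /low_seg halfpowS; have [] := halfpow k; lra. Qed.

Lemma high_seg_range k x : high_seg k x -> 0 < x < 1.
Proof. rewrite /high_seg halfpowS; have [] := halfpow k; lra. Qed.

Lemma low_seg_inj k j x : low_seg k x -> low_seg j x -> k = j.
Proof.
move=> /andP[k1 k2] /andP[j1 j2]; apply/eqP; rewrite eqn_leq.
by apply/andP; split; apply: halfpow_gtS; lra.
Qed.

Lemma high_seg_inj k j x : high_seg k x -> high_seg j x -> k = j.
Proof.
move=> /andP[k1 k2] /andP[j1 j2]; apply/eqP; rewrite eqn_leq.
by apply/andP; split; apply: halfpow_gtS; lra.
Qed.

Lemma high_seg_shift k x : high_seg k (x + seg_shift R k) = low_seg k x.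
Proof.
by rewrite /high_seg /low_seg /seg_shift halfpowS; apply/idP/idP; lra.
Qed.

(** This is the action of the baker map on the left edge; its inverse, in [low_segP], is the action
    on the part of the bottom edge beyond x = 1/2. *)
Lemma low_segS k x : low_seg k x -> low_seg k.+1 (x / 2 + 2^-1).
Proof. by rewrite /low_seg !halfpowS; lra. Qed.

Lemma low_segP k x : low_seg k.+1 x -> low_seg k (2 * x - 1).
Proof. by rewrite /low_seg !halfpowS; lra. Qed.

(** Equivalently [y / 2 + 1/2 + seg_shift R k.+1 = (y + seg_shift R k) / 2]: the baker map carries
    one gluing to the next. *)
Lemma seg_shiftS k : seg_shift R k.+1 = (seg_shift R k - 1) / 2.
Proof. by rewrite /seg_shift !halfpowS; lra. Qed.

Lemma seg_shift0 : seg_shift R 0 = 2^-1.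
Proof. by rewrite /seg_shift halfpowS expr0; lra. Qed.

Lemma low_seg_near k x : low_seg k x ->
  exists2 e : R, 0 < e & forall t, `|t| < e -> low_seg k (x + t).
Proof.
move=> /andP[h1 h2].
exists (Num.min (x - (1 - 2 ^- k)) (1 - 2 ^- k.+1 - x)).
  by rewrite lt_min; apply/andP; split; lra.
move=> t; rewrite lt_min => /andP[/ltr_normlP[? ?] /ltr_normlP[? ?]].
by apply/andP; split; lra.
Qed.

(** The segments are disjoint, so at most one value qualifies; the default 0 off the segments is
    junk. *)
Definition low_shift x : R :=
  xget 0 [set s | exists k, low_seg k x /\ s = seg_shift R k].

Definition high_shift x : R :=
  xget 0 [set s | exists k, high_seg k x /\ s = seg_shift R k].

Lemma low_shiftE k x : low_seg k x -> low_shift x = seg_shift R k.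
Proof.
move=> h; rewrite /low_shift; case: xgetP => [_ _ [j [hj ->]]|/(_ (seg_shift R k))].
  by rewrite (low_seg_inj h hj).
by case; exists k.
Qed.

Lemma high_shiftE k x : high_seg k x -> high_shift x = seg_shift R k.
Proof.
move=> h; rewrite /high_shift; case: xgetP => [_ _ [j [hj ->]]|/(_ (seg_shift R k))].
  by rewrite (high_seg_inj h hj).
by case; exists k.
Qed.

End Segments.

(** * Coordinates and germs at the origin of the plane *)

Section Plane.
Context {R : realType}.
Local Notation plane := 'cV[R]_2.

Lemma pt00 (a b : R) : pt a b 0 0 = a. Proof. by rewrite mxE. Qed.
Lemma pt10 (a b : R) : pt a b 1 0 = b. Proof. by rewrite mxE. Qed.

Lemma ptK (q : plane) : pt (q 0 0) (q 1 0) = q.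
Proof.
apply/matrixP => i j; rewrite mxE (ord1 j).
by case: i => [[|[|//]]] hi /=; congr (q _ _); apply/val_inj.
Qed.

Lemma pt_inj (a b c d : R) : pt a b = pt c d -> a = c /\ b = d.
Proof. by move=> h; split; [rewrite -(pt00 a b) h pt00 | rewrite -(pt10 a b) h pt10]. Qed.

Lemma ptD (a b c d : R) : pt a b + pt c d = pt (a + c) (b + d).
Proof. by apply/matrixP => i j; rewrite !mxE; case: ifP. Qed.

Lemma mulmx_pt (M : 'M[R]_2) (a b : R) :
  M *m pt a b = pt (M 0 0 * a + M 0 1 * b) (M 1 0 * a + M 1 1 * b).
Proof.
rewrite -[LHS]ptK !mxE !big_ord_recl !big_ord0 !addr0 !mxE /=.
by congr (pt (M _ _ * _ + M _ _ * _) (M _ _ * _ + M _ _ * _)); apply/val_inj.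
Qed.

Lemma near0_ptP (P : plane -> Prop) :
  (\forall t \near (0 : plane), P t) <->
  exists2 e : R, 0 < e & forall a b, `|a| < e -> `|b| < e -> P (pt a b).
Proof.
split.
- move=> /nbhs_ballP[e /= e0 eP]; exists e => // a b ha hb; apply: eP.
  by split=> // i j; rewrite !mxE /ball /= sub0r normrN; case: ifP.
- move=> [e e0 eP]; apply/nbhs_ballP; exists e => //= t [_ tb].
  rewrite -(ptK t); apply: eP.
  + by have := tb 0 0; rewrite mxE /ball /= sub0r normrN.
  + by have := tb 1 0; rewrite mxE /ball /= sub0r normrN.
Qed.

Lemma near0W (P : plane -> Prop) :
  (forall t, P t) -> \forall t \near (0 : plane), P t.
Proof. by move=> h; apply: (@nearW _ (nbhs (0 : plane)) P). Qed.

Lemma near0S (P Q : plane -> Prop) : (forall t, P t -> Q t) ->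
  (\forall t \near (0 : plane), P t) -> \forall t \near (0 : plane), Q t.
Proof. exact: filterS. Qed.

Lemma near0S2 (P P' Q : plane -> Prop) : (forall t, P t -> P' t -> Q t) ->
  (\forall t \near (0 : plane), P t) -> (\forall t \near (0 : plane), P' t) ->
  \forall t \near (0 : plane), Q t.
Proof. exact: filterS2. Qed.

Lemma near_addP (q : plane) (P : plane -> Prop) :
  (\forall t \near (0 : plane), P (q + t)) <-> \forall t \near q, P t.
Proof.
split => /nbhs_ballP[e /= e0 eP]; apply/nbhs_ballP; exists e => //= t tq.
- rewrite -(subrK q t) addrC; apply: eP.
  by move: tq; rewrite -!ball_normE /= sub0r normrN distrC.
- by apply: eP; move: tq; rewrite -!ball_normE /= sub0r opprD addNKr.
Qed.

Lemma near0_mulmx (M : 'M[R]_2) (P : plane -> Prop) :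
  (\forall t \near (0 : plane), P t) -> \forall t \near (0 : plane), P (M *m t).
Proof.
move=> /near0_ptP[e e0 eP]; apply/near0_ptP.
(* The summand 1 makes [K] positive and strictly larger than the sum of absolute values in each row,
   also for [M = 0]. *)
pose K := 1 + `|M 0 0| + `|M 0 1| + `|M 1 0| + `|M 1 1|.
have n0 := normr_ge0.
have K0 : 0 < K.
  by rewrite /K; have := n0 _ _ (M 0 0); have := n0 _ _ (M 0 1); have := n0 _ _ (M 1 0); have := n0 _ _ (M 1 1); lra.
exists (e / K); first exact: divr_gt0.
move=> a b ha hb; rewrite mulmx_pt.
have key u v : `|u| + `|v| < K -> `|u * a + v * b| < e.
  move=> uv; apply: le_lt_trans (ler_normD _ _) _; rewrite !normrM.
  apply: (@le_lt_trans _ _ ((`|u| + `|v|) * (e / K))).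
    by rewrite mulrDl lerD // ler_wpM2l // ltW.
  by rewrite mulrCA gtr_pMr // ltr_pdivrMr // mul1r.
have := n0 _ _ (M 0 0); have := n0 _ _ (M 0 1).
have := n0 _ _ (M 1 0); have := n0 _ _ (M 1 1) => ? ? ? ?.
by apply: eP; apply: key; rewrite /K; lra.
Qed.

End Plane.

(** * The developing map *)

Section Developing.
Context {R : realType}.
Local Notation plane := 'cV[R]_2.
Local Notation X := (chamanara R).
Local Notation shift := (seg_shift R).

Lemma squareP (a b : R) : square (pt a b) <->
  [\/ 0 < a < 1 /\ 0 < b < 1, exists k, a = 0 /\ low_seg k b,
      exists k, a = 1 /\ high_seg k b |
      exists k, (low_seg k a /\ b = 0) \/ (high_seg k a /\ b = 1)].
Proof.
split=> [[x [y [/pt_inj[-> ->]]]]//|h].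
by exists a, b.
Qed.

Lemma square_range (a b : R) : square (pt a b) -> (0 <= a <= 1) /\ (0 <= b <= 1).
Proof.
by move=> /squareP[[? ?]|[k [-> /low_seg_range]]|[k [-> /high_seg_range]]
  |[k [[/low_seg_range + ->]|[/high_seg_range + ->]]]]; split; lra.
Qed.

(** Total on the plane, so that points can be moved by arithmetic without membership proofs; the
    centre is a junk value off the square. *)
Definition class_pt (q : plane) : X :=
  match pselect (q \in @square R) with
  | left h => chamanara_pt (exist (fun v => v \in @square R) q h)
  | right _ => chamanara_center R
  end.

Lemma class_ptE (v : set_type (@square R)) : class_pt (set_val v) = chamanara_pt v.
Proof.
rewrite /class_pt; case: pselect => [h|h].
  by congr chamanara_pt; exact/val_inj.
by case: h; exact: valP v.
Qed.

Lemma class_pt_mem (q : plane) (h : q \in @square R) :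
  class_pt q = chamanara_pt (exist (fun v => v \in @square R) q h).
Proof. by rewrite -class_ptE. Qed.

Lemma class_pt_surj (x : X) : exists2 q, @square R q & x = class_pt q.
Proof.
exists (set_val (generic_quotient.repr (x : gen_quot (@Defs.glue R)))).
  exact/set_mem/valP.
by rewrite class_ptE /chamanara_pt /quot_class /gen_class reprK.
Qed.

Lemma gen_class_eqP (T : choiceType) (r : T -> T -> Prop) (v w : T) :
  gen_class r v = gen_class r w <-> clos_refl_sym_trans T r v w.
Proof. by split=> [/eqquotP/asboolP|h]; last exact/eqquotP/asboolP. Qed.

Lemma class_pt_glue (v w : plane) : @square R v -> @square R w ->
  (exists k, (exists2 y, low_seg k y & v = pt 0 y /\ w = pt 1 (y + shift k)) \/
    (exists2 x, low_seg k x & v = pt x 0 /\ w = pt (x + shift k) 1)) ->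
  class_pt v = class_pt w.
Proof.
move=> /mem_set sv /mem_set sw h.
rewrite (class_pt_mem sv) (class_pt_mem sw).
by apply/gen_class_eqP/rst_step.
Qed.

Lemma class_pt_LR k (y : R) : low_seg k y ->
  class_pt (pt 0 y) = class_pt (pt 1 (y + shift k)).
Proof.
move=> h; apply: class_pt_glue.
- by apply/squareP/Or42; exists k.
- by apply/squareP/Or43; exists k; rewrite high_seg_shift.
- by exists k; left; exists y.
Qed.

Lemma class_pt_BT k (x : R) : low_seg k x ->
  class_pt (pt x 0) = class_pt (pt (x + shift k) 1).
Proof.
move=> h; apply: class_pt_glue.
- by apply/squareP/Or44; exists k; left.
- by apply/squareP/Or44; exists k; right; rewrite high_seg_shift.
- by exists k; right; exists x.
Qed.

(** The normal form [red], which moves right and top edge points to their partners, is invariant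
    under gluing and fixes every point with both coordinates below 1. *)
Lemma class_pt_inj (v w : plane) : @square R v -> @square R w ->
  v 0 0 < 1 -> v 1 0 < 1 -> w 0 0 < 1 -> w 1 0 < 1 ->
  class_pt v = class_pt w -> v = w.
Proof.
move=> /mem_set sv /mem_set sw.
rewrite (class_pt_mem sv) (class_pt_mem sw).
pose red (u : plane) : plane :=
  if u 0 0 == 1 then pt 0 (u 1 0 - high_shift (u 1 0))
  else if u 1 0 == 1 then pt (u 0 0 - high_shift (u 0 0)) 0 else u.
have redE (u : plane) : u 0 0 < 1 -> u 1 0 < 1 -> red u = u.
  by move=> h1 h2; rewrite /red !lt_eqF.
have step (c d : set_type (@square R)) : Defs.glue c d -> red (set_val c) = red (set_val d).
  move=> [k [[y hy [-> ->]]|[y hy [-> ->]]]]; rewrite /red !pt00 !pt10.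
  - have := low_seg_range hy => ?.
    rewrite eqxx !ifF ?(@high_shiftE _ k) ?high_seg_shift ?addrK //.
      by apply/negbTE; lra.
    by apply/negbTE; lra.
  - have := low_seg_range hy; have := hy; rewrite -high_seg_shift.
    move=> /[dup] /high_seg_range h1 h2 h3.
    rewrite eqxx !ifF ?(high_shiftE h2) ?addrK //; apply/negbTE; lra.
move=> v0 v1 w0 w1 /gen_class_eqP h.
suff : red v = red w by rewrite !redE.
have hr : forall c d, clos_refl_sym_trans _ (@Defs.glue R) c d ->
    red (set_val c) = red (set_val d).
  by move=> c d; elim=> [? ? /step|//|? ? _ -> //|? ? ? _ -> _ ->].
exact: hr _ _ h.
Qed.

(* [dev] prolongs the square across its edges, so that near every point of the
   square, edges included, it is a local inverse of a chart.  It is junk away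
   from the square, in particular around the corners and segment endpoints. *)
Definition fold_pt (a b : R) : plane :=
  if a < 0 then pt (a + 1) (b + low_shift b)
  else if 1 < a then pt (a - 1) (b - high_shift b)
  else if b < 0 then pt (a + low_shift a) (b + 1)
  else if 1 < b then pt (a - high_shift a) (b - 1)
  else pt a b.

Definition dev (q : plane) : X := class_pt (fold_pt (q 0 0) (q 1 0)).

Lemma dev_in (a b : R) : 0 <= a <= 1 -> 0 <= b <= 1 ->
  dev (pt a b) = class_pt (pt a b).
Proof.
move=> ha hb; rewrite /dev /fold_pt pt00 pt10.
by rewrite !ifF //; apply/negbTE; rewrite -leNgt; lra.
Qed.

Lemma dev_L k (a b : R) : a < 0 -> low_seg k b ->
  dev (pt a b) = class_pt (pt (a + 1) (b + shift k)).
Proof. by move=> ha hb; rewrite /dev /fold_pt pt00 pt10 ha (low_shiftE hb). Qed.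

Lemma dev_R k (a b : R) : 1 < a -> high_seg k b ->
  dev (pt a b) = class_pt (pt (a - 1) (b - shift k)).
Proof.
move=> ha hb; rewrite /dev /fold_pt pt00 pt10 ha (high_shiftE hb) ifF //.
by apply/negbTE; rewrite -leNgt; lra.
Qed.

Lemma dev_B k (a b : R) : b < 0 -> low_seg k a ->
  dev (pt a b) = class_pt (pt (a + shift k) (b + 1)).
Proof.
move=> hb ha; rewrite /dev /fold_pt pt00 pt10 hb (low_shiftE ha).
have := low_seg_range ha => ?.
by rewrite !ifF //; apply/negbTE; rewrite -leNgt; lra.
Qed.

Lemma dev_T k (a b : R) : 1 < b -> high_seg k a ->
  dev (pt a b) = class_pt (pt (a - shift k) (b - 1)).
Proof.
move=> hb ha; rewrite /dev /fold_pt pt00 pt10 hb (high_shiftE ha).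
have := high_seg_range ha => ?.
by rewrite !ifF //; apply/negbTE; rewrite -leNgt; lra.
Qed.

Lemma dev_square (q : plane) : @square R q -> dev q = class_pt q.
Proof. by rewrite -(ptK q) => /square_range[? ?]; rewrite dev_in. Qed.

(** A disc around a glued point consists of two half-discs. Each of the two representatives sees one
    of them inside the square and the other through the fold, so the germs agree half by half. *)
Lemma dev_LR k (y : R) : low_seg k y ->
  \forall t \near (0 : plane), dev (pt 0 y + t) = dev (pt 1 (y + shift k) + t).
Proof.
(* The bound [e] keeps the point level with segment [k]; the bound 1/2 keeps the folded point inside
   the square. *)
move=> hy; apply/near0_ptP; have [e e0 he] := low_seg_near hy.
exists (Num.min e (1/2)); first by rewrite lt_min e0; lra.
move=> a b; rewrite !lt_min => /andP[_ /ltr_normlP[a1 a2]] /andP[/he hb _].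
rewrite !ptD add0r addrAC.
have hb' : high_seg k (y + b + shift k) by rewrite high_seg_shift.
have := low_seg_range hb; have := high_seg_range hb' => ? ?.
have [a0|a0|->] := ltgtP a 0.
- by rewrite (dev_L _ hb) // dev_in ?[1 + a]addrC //; lra.
- rewrite (dev_R _ hb') ?addrK; last lra.
  rewrite (_ : 1 + a - 1 = a); last lra.
  by rewrite dev_in //; lra.
- by rewrite addr0 !dev_in ?(class_pt_LR hb) //; lra.
Qed.

Lemma dev_BT k (x : R) : low_seg k x ->
  \forall t \near (0 : plane), dev (pt x 0 + t) = dev (pt (x + shift k) 1 + t).
Proof.
move=> hy; apply/near0_ptP; have [e e0 he] := low_seg_near hy.
exists (Num.min e (1/2)); first by rewrite lt_min e0; lra.
move=> b a; rewrite !lt_min => /andP[/he hb _] /andP[_ /ltr_normlP[a1 a2]].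
rewrite !ptD add0r addrAC.
have hb' : high_seg k (x + b + shift k) by rewrite high_seg_shift.
have := low_seg_range hb; have := high_seg_range hb' => ? ?.
have [a0|a0|->] := ltgtP a 0.
- by rewrite (dev_B _ hb) // dev_in ?[1 + a]addrC //; lra.
- rewrite (dev_T _ hb') ?addrK; last lra.
  rewrite (_ : 1 + a - 1 = a); last lra.
  by rewrite dev_in //; lra.
- by rewrite addr0 !dev_in ?(class_pt_BT hb) //; lra.
Qed.

(** Induction along the chain of gluings, with links [dev_LR] and [dev_BT]: the germ of [dev]
    depends on the point of X alone, not on its representative. *)
Lemma dev_eq_near (v w : plane) : @square R v -> @square R w -> dev v = dev w ->
  \forall t \near (0 : plane), dev (v + t) = dev (w + t).
Proof.
move=> sv sw; rewrite !dev_square //.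
move: sv sw => /mem_set sv /mem_set sw.
rewrite (class_pt_mem sv) (class_pt_mem sw).
move=> /gen_class_eqP h.
have hr : forall c d, clos_refl_sym_trans _ (@Defs.glue R) c d ->
    \forall t \near (0 : plane), dev (set_val c + t) = dev (set_val d + t).
  move=> c d; elim=> [{}c {}d [k [[y hy [-> ->]]|[x hx [-> ->]]]]|{}c|{}c {}d _|].
  - exact: (dev_LR hy).
  - exact: (dev_BT hx).
  - exact: near0W.
  - by apply: near0S => t ->.
  - by move=> ? ? ? _ h1 _; move: h1; apply: near0S2 => t -> ->.
exact: hr _ _ h.
Qed.

(** A fundamental domain that keeps one edge of each glued pair, so that local claims need three
    cases instead of five. *)
Variant low_rep : plane -> Prop :=
| RepI (a b : R) of 0 < a < 1 & 0 < b < 1 : low_rep (pt a b)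
| RepL k (b : R) of low_seg k b : low_rep (pt 0 b)
| RepB k (a : R) of low_seg k a : low_rep (pt a 0).

Lemma low_rep_square (q : plane) : low_rep q -> @square R q.
Proof.
move=> [a b ? ?|k b h|k a h]; apply/squareP.
- exact: Or41.
- by apply: Or42; exists k.
- by apply: Or44; exists k; left.
Qed.

Lemma low_rep_surj (x : X) : exists2 q, low_rep q & x = dev q.
Proof.
have [q sq ->] := class_pt_surj x; rewrite -dev_square //.
move: sq; rewrite -(ptK q); move: (q 0 0) (q 1 0) => a b sq.
have /squareP[[ha hb]|[k [a0 hb]]|[k [a1 hb]]|[k [[ha b0]|[ha b1]]]] := sq.
- by exists (pt a b) => //; exact: RepI.
- by rewrite a0; exists (pt 0 b) => //; exact: (RepL hb).
- have h : low_seg k (b - shift k) by rewrite -high_seg_shift subrK.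
  exists (pt 0 (b - shift k)); first exact: RepL h.
  rewrite dev_square // dev_square; last exact/low_rep_square/(RepL h).
  by rewrite (class_pt_LR h) a1 subrK.
- by rewrite b0; exists (pt a 0) => //; exact: (RepB ha).
- have h : low_seg k (a - shift k) by rewrite -high_seg_shift subrK.
  exists (pt (a - shift k) 0); first exact: RepB h.
  rewrite dev_square // dev_square; last exact/low_rep_square/(RepB h).
  by rewrite (class_pt_BT h) b1 subrK.
Qed.

Lemma low_rep_near (v : plane) : @square R v -> exists w, [/\ low_rep w, dev v = dev w &
  \forall t \near (0 : plane), dev (v + t) = dev (w + t)].
Proof.
move=> sv; have [w lw e] := low_rep_surj (dev v); exists w; split => //.
by apply: dev_eq_near => //; exact: low_rep_square.
Qed.

Lemma near_interior (a b : R) : 0 < a < 1 -> 0 < b < 1 ->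
  \forall t \near (0 : plane), 0 < (pt a b + t) 0 0 < 1 /\ 0 < (pt a b + t) 1 0 < 1.
Proof.
move=> ha hb; apply/near0_ptP.
exists (Num.min (Num.min a (1 - a)) (Num.min b (1 - b))).
  by rewrite !lt_min; apply/andP; split; apply/andP; split; lra.
move=> s t; rewrite !lt_min.
move=> /andP[/andP[/ltr_normlP[? ?] /ltr_normlP[? ?]] _].
move=> /andP[_ /andP[/ltr_normlP[? ?] /ltr_normlP[? ?]]].
by rewrite ptD pt00 pt10; split; lra.
Qed.

Lemma near_interior_square (a b : R) : 0 < a < 1 -> 0 < b < 1 ->
  \forall t \near (0 : plane), @square R (pt a b + t).
Proof.
move=> ha hb; apply: near0S (near_interior ha hb) => t.
by case=> h1 h2; rewrite -[pt a b + t]ptK; apply/squareP/Or41.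
Qed.

(** Continuity of the quotient map in the subspace topology of the square, which controls only the
    translates that stay in the square. *)
Lemma class_nbhs (v : plane) (W : set X) : @square R v -> nbhs (class_pt v) W ->
  \forall t \near (0 : plane), @square R (v + t) -> W (class_pt (v + t)).
Proof.
move=> /mem_set sv; rewrite (class_pt_mem sv) => nW.
have := @pi_continuous _ (gen_quot (@Defs.glue R)) (exist _ v sv) _ nW.
case=> _ [] [] O oO <- Ov OW.
have : nbhs v O by apply: open_nbhs_nbhs.
move=> /near_addP; apply: near0S => t Ot st.
have := OW (exist _ (v + t) (mem_set st)) Ot; rewrite /= /preimage /=.
by rewrite -[X in W X -> _]/(chamanara_pt _) -class_ptE.
Qed.

(** At an edge point [class_nbhs] is applied at both glued representatives, one for each half of the
    disc. *)
Lemma dev_continuous (v : plane) (W : set X) : @square R v ->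
  nbhs (dev v) W -> \forall t \near (0 : plane), W (dev (v + t)).
Proof.
move=> sv; have [w [lw -> vw]] := low_rep_near sv.
move=> nW; suff : \forall t \near (0 : plane), W (dev (w + t)).
  by move: vw; apply: near0S2 => t ->.
case: lw nW => {v sv w vw} [a b ha hb|k b hb|k a ha] nW.
- have := near_interior_square ha hb.
  have sw : @square R (pt a b) by apply/low_rep_square/RepI.
  rewrite dev_square // in nW.
  have := class_nbhs sw nW; apply: near0S2 => t h st.
  by rewrite dev_square //; exact: h.
- have s0 := low_rep_square (RepL hb).
  have s1 : @square R (pt 1 (b + shift k)).
    by apply/squareP/Or43; exists k; rewrite high_seg_shift.
  rewrite dev_square // in nW.
  have n0 := class_nbhs s0 nW; rewrite (class_pt_LR hb) in nW.
  have n1 := class_nbhs s1 nW.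
  have [e e0 he] := low_seg_near hb.
  have [d d0 hd] := (@near0_ptP _ _).1 (filterI n0 n1).
  apply/near0_ptP; exists (Num.min d (Num.min e (1/2))).
    by rewrite !lt_min d0 e0; lra.
  move=> s t; rewrite !lt_min => /andP[sd /andP[_ /ltr_normlP[? ?]]] /andP[td /andP[/he ht _]].
  have [] := hd _ _ sd td; rewrite !ptD add0r.
  have ht' : high_seg k (b + t + shift k) by rewrite high_seg_shift.
  have := low_seg_range ht; have := high_seg_range ht' => ? ?.
  have [s0'|s0'] := ltP s 0.
  + rewrite (dev_L _ ht) // => _; rewrite [1 + s]addrC addrAC; apply.
    by apply/squareP/Or41; split; lra.
  + rewrite dev_in; [|lra|lra] => + _; apply; apply/squareP.
    move: s0'; rewrite le_eqVlt => /predU1P[<-|s0']; first by apply: Or42; exists k.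
    by apply/Or41; split; lra.
- have s0 := low_rep_square (RepB ha).
  have s1 : @square R (pt (a + shift k) 1).
    by apply/squareP/Or44; exists k; right; rewrite high_seg_shift.
  rewrite dev_square // in nW.
  have n0 := class_nbhs s0 nW; rewrite (class_pt_BT ha) in nW.
  have n1 := class_nbhs s1 nW.
  have [e e0 he] := low_seg_near ha.
  have [d d0 hd] := (@near0_ptP _ _).1 (filterI n0 n1).
  apply/near0_ptP; exists (Num.min d (Num.min e (1/2))).
    by rewrite !lt_min d0 e0; lra.
  move=> t s; rewrite !lt_min => /andP[td /andP[/he ht _]] /andP[sd /andP[_ /ltr_normlP[? ?]]].
  have [] := hd _ _ td sd; rewrite !ptD add0r.
  have ht' : high_seg k (a + t + shift k) by rewrite high_seg_shift.
  have := low_seg_range ht; have := high_seg_range ht' => ? ?.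
  have [s0'|s0'] := ltP s 0.
  + rewrite (dev_B _ ht) // => _; rewrite [1 + s]addrC [a + shift k + t]addrAC; apply.
    by apply/squareP/Or41; split; lra.
  + rewrite dev_in; [|lra|lra] => + _; apply; apply/squareP.
    move: s0'; rewrite le_eqVlt => /predU1P[<-|s0']; first by apply: Or44; exists k; left.
    by apply/Or41; split; lra.
Qed.

(** The set [Wo] asks for one representative in the open set [P]; by [dev_eq_near] all
    representatives then lie in [P]. Hence the preimage of [Wo] in the square is the trace of [P],
    and [Wo] is open in the quotient. *)
Lemma dev_open (v : plane) (W : set X) : @square R v ->
  (\forall t \near (0 : plane), W (dev (v + t))) -> nbhs (dev v) W.
Proof.
move=> sv nW.
pose P : set plane := (dev @^-1` W)°.
have PE (q : plane) : P q <-> \forall t \near (0 : plane), W (dev (q + t)).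
  exact: iff_sym (near_addP q (fun t => W (dev t))).
pose Wo : set X := [set x | exists q, [/\ @square R q, x = dev q & P q]].
have Pinv q q' : @square R q -> @square R q' -> dev q = dev q' -> P q -> P q'.
  move=> sq sq' /(dev_eq_near sq sq') e /PE h; apply/PE; move: e h.
  by apply: near0S2 => t ->.
rewrite nbhsE; exists Wo; last first.
  by move=> _ [q [sq -> Pq]]; exact: (interior_subset Pq).
split; last by exists v; split => //; exact/PE.
exists P; first exact: open_interior.
rewrite set_valE; apply/seteqP; split => w /=.
- move=> Pw; exists (set_val w); split => //; first exact/set_mem/valP.
  rewrite dev_square; last exact/set_mem/valP.
  exact: esym (class_ptE w).
- move=> [q [sq e Pq]]; apply: (Pinv q) => //; first exact/set_mem/valP.
  rewrite -e dev_square; last exact/set_mem/valP.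
  exact: esym (class_ptE w).
Qed.

End Developing.

(** * Charts and locally linear maps *)

Section LocalStructure.
Context {R : realType}.
Local Notation plane := 'cV[R]_2.
Local Notation X := (chamanara R).
Local Notation shift := (seg_shift R).
Local Notation square := (@square R).

Lemma square_low_L k (a b : R) : 0 <= a < 1 -> low_seg k b -> square (pt a b).
Proof.
move=> + hb; have := low_seg_range hb; rewrite le_eqVlt => ? /andP[/predU1P[<-|?] ?].
  by apply/squareP/Or42; exists k.
by apply/squareP/Or41; split; lra.
Qed.

Lemma square_low_B k (a b : R) : 0 <= b < 1 -> low_seg k a -> square (pt a b).
Proof.
move=> + hb; have := low_seg_range hb; rewrite le_eqVlt => ? /andP[/predU1P[<-|?] ?].
  by apply/squareP/Or44; exists k; left.
by apply/squareP/Or41; split; lra.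
Qed.

Lemma square_in (a b : R) : 0 < a < 1 -> 0 < b < 1 -> square (pt a b).
Proof. by move=> ? ?; apply/squareP/Or41. Qed.

(** A ball around an edge point sticks out of the square; this isolates the points where [dev] keeps
    the properties proved on the square. *)
Definition dev_good (q : plane) : Prop :=
  exists2 w, square w & \forall t \near (0 : plane), dev (q + t) = dev (w + t).

Lemma dev_good_square q : square q -> dev_good q.
Proof. by move=> sq; exists q => //; exact: near0W. Qed.

Lemma dev_good_val q : dev_good q ->
  exists w, [/\ square w, dev q = dev w &
    \forall t \near (0 : plane), dev (q + t) = dev (w + t)].
Proof.
move=> [w sw h]; exists w; split => //.
by have := nbhs_singleton h; rewrite !addr0.
Qed.

Lemma dev_eq_near_good (q q' : plane) : dev_good q -> dev_good q' ->
  dev q = dev q' -> \forall t \near (0 : plane), dev (q + t) = dev (q' + t).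
Proof.
move=> /dev_good_val[w [sw -> h]] /dev_good_val[w' [sw' -> h']] e.
have := dev_eq_near sw sw' e; move: h; apply: filterS3 h' => t -> -> //.
Qed.

Lemma dev_continuous_good (q : plane) (W : set X) : dev_good q ->
  nbhs (dev q) W -> \forall t \near (0 : plane), W (dev (q + t)).
Proof.
move=> /dev_good_val[w [sw -> h]] /(dev_continuous sw).
by move: h; apply: near0S2 => t ->.
Qed.

Lemma dev_open_good (q : plane) (W : set X) : dev_good q ->
  (\forall t \near (0 : plane), W (dev (q + t))) -> nbhs (dev q) W.
Proof.
move=> /dev_good_val[w [sw -> h]] nW; apply: dev_open => //.
by move: h nW; apply: near0S2 => t ->.
Qed.

(** Prepares the charts: nearby points fold to points of the square with coordinates below 1, where
    [class_pt_inj] applies. *)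
Lemma low_rep_local (v : plane) : low_rep v -> exists2 e : R, 0 < e &
  forall a b, `|a| < e -> `|b| < e -> dev_good (v + pt a b) /\
  forall a' b', `|a'| < e -> `|b'| < e ->
    dev (v + pt a b) = dev (v + pt a' b') -> a = a' /\ b = b'.
Proof.
case=> [x y hx hy|k y hy|k x hx].
- exists (Num.min (Num.min x (1 - x)) (Num.min y (1 - y))).
    by rewrite !lt_min; apply/andP; split; apply/andP; split; lra.
  have key a b : `|a| < Num.min (Num.min x (1 - x)) (Num.min y (1 - y)) ->
      `|b| < Num.min (Num.min x (1 - x)) (Num.min y (1 - y)) ->
      0 < x + a < 1 /\ 0 < y + b < 1.
    rewrite !lt_min => /andP[/andP[/ltr_normlP[? ?] /ltr_normlP[? ?]] _].
    by move=> /andP[_ /andP[/ltr_normlP[? ?] /ltr_normlP[? ?]]]; split; lra.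
  move=> a b ha hb; have [h1 h2] := key _ _ ha hb.
  split=> [|a' b' ha' hb']; first by rewrite ptD; exact/dev_good_square/square_in.
  have [h3 h4] := key _ _ ha' hb'; rewrite !ptD !dev_in; try lra.
  move/class_pt_inj; rewrite !pt00 !pt10 => h.
  have /pt_inj[] : pt (x + a) (y + b) = pt (x + a') (y + b').
    by apply: h; [exact: square_in|exact: square_in|lra|lra|lra|lra].
  by split; lra.
- have [e e0 he] := low_seg_near hy.
  exists (Num.min e (1/2)); first by rewrite lt_min e0; lra.
  (* The test [c < 1/2] recovers the side of the edge: a point left of it is folded into the right
     half of the square, so [(c, d)] determines [(a, b)]. *)
  have fold a b : `|a| < Num.min e (1 / 2) -> `|b| < Num.min e (1 / 2) ->
    exists c d, [/\ dev (pt 0 y + pt a b) = class_pt (pt c d),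
      square (pt c d), c < 1, d < 1 &
      if c < 1/2 then a = c /\ b = d - y
      else a = c - 1 /\ b = d - y - shift k].
    rewrite !lt_min => /andP[_ /ltr_normlP[a1 a2]] /andP[/he hb _].
    have hb' : high_seg k (y + b + shift k) by rewrite high_seg_shift.
    have := low_seg_range hb; have := high_seg_range hb' => ? ?.
    rewrite ptD add0r; have [a0|a0] := ltP a 0.
    + exists (a + 1), (y + b + shift k); split; [exact: dev_L|apply: square_in; lra|lra|lra|].
      by rewrite ifF; [split; lra|apply/negbTE; lra].
    + exists a, (y + b); split; [by rewrite dev_in //; lra|apply: (square_low_L _ hb); lra|lra|lra|].
      by rewrite ifT; [split; lra|lra].
  move=> a b ha hb; split => [|a' b' ha' hb'].
    move: ha hb; rewrite !lt_min => /andP[_ /ltr_normlP[a1 a2]] /andP[/he hb _].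
    have hb' : high_seg k (y + b + shift k) by rewrite high_seg_shift.
    have := low_seg_range hb; have := high_seg_range hb' => ? ?.
    rewrite ptD add0r; have [a0|a0] := ltP a 0; last first.
      by apply/dev_good_square/(square_low_L _ hb); lra.
    exists (pt (a + 1) (y + b + shift k)); first by apply: square_in; lra.
    have [d d0 hd] := low_seg_near hb.
    (* The bound [-a] keeps the translates beyond the edge, and 1/2 keeps their folds inside the
       square. *)
    apply/near0_ptP; exists (Num.min d (Num.min (-a) (1/2))).
      by rewrite !lt_min d0; apply/andP; split; lra.
    move=> s t; rewrite !lt_min.
    move=> /andP[_ /andP[/ltr_normlP[? ?] /ltr_normlP[? ?]]] /andP[/hd ht _].
    have ht' : high_seg k (y + b + t + shift k) by rewrite high_seg_shift.
    have := low_seg_range ht; have := high_seg_range ht' => ? ?.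
    rewrite !ptD (dev_L _ ht); last lra.
    by rewrite [a + 1 + s]addrAC [y + b + _ + t]addrAC dev_in //; lra.
  have [c [d [-> s1 c1 d1 h]]] := fold _ _ ha hb.
  have [c' [d' [-> s2 c2 d2 h']]] := fold _ _ ha' hb'.
  move/class_pt_inj; rewrite !pt00 !pt10 => /(_ s1 s2 c1 d1 c2 d2) /pt_inj[ec ed].
  by move: h h'; rewrite ec ed; case: ifP => _ [-> ->] [-> ->].
- have [e e0 he] := low_seg_near hx.
  exists (Num.min e (1/2)); first by rewrite lt_min e0; lra.
  have fold a b : `|a| < Num.min e (1 / 2) -> `|b| < Num.min e (1 / 2) ->
    exists c d, [/\ dev (pt x 0 + pt a b) = class_pt (pt c d),
      square (pt c d), c < 1, d < 1 &
      if d < 1/2 then a = c - x /\ b = d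
      else a = c - x - shift k /\ b = d - 1].
    rewrite !lt_min => /andP[/he hb _] /andP[_ /ltr_normlP[a1 a2]].
    have hb' : high_seg k (x + a + shift k) by rewrite high_seg_shift.
    have := low_seg_range hb; have := high_seg_range hb' => ? ?.
    rewrite ptD add0r; have [a0|a0] := ltP b 0.
    + exists (x + a + shift k), (b + 1); split; [exact: dev_B|apply: square_in; lra|lra|lra|].
      by rewrite ifF; [split; lra|apply/negbTE; lra].
    + exists (x + a), b; split; [by rewrite dev_in //; lra|apply: (square_low_B _ hb); lra|lra|lra|].
      by rewrite ifT; [split; lra|lra].
  move=> a b ha hb; split => [|a' b' ha' hb'].
    move: hb ha; rewrite !lt_min => /andP[_ /ltr_normlP[a1 a2]] /andP[/he hb _].
    have hb' : high_seg k (x + a + shift k) by rewrite high_seg_shift.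
    have := low_seg_range hb; have := high_seg_range hb' => ? ?.
    rewrite ptD add0r; have [a0|a0] := ltP b 0; last first.
      by apply/dev_good_square/(square_low_B _ hb); lra.
    exists (pt (x + a + shift k) (b + 1)); first by apply: square_in; lra.
    have [d d0 hd] := low_seg_near hb.
    apply/near0_ptP; exists (Num.min d (Num.min (-b) (1/2))).
      by rewrite !lt_min d0; apply/andP; split; lra.
    move=> t s; rewrite !lt_min.
    move=> /andP[/hd ht _] /andP[_ /andP[/ltr_normlP[? ?] /ltr_normlP[? ?]]].
    have ht' : high_seg k (x + a + t + shift k) by rewrite high_seg_shift.
    have := low_seg_range ht; have := high_seg_range ht' => ? ?.
    rewrite !ptD (dev_B _ ht); last lra.
    by rewrite [b + 1 + s]addrAC [x + a + _ + t]addrAC dev_in //; lra.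
  have [c [d [-> s1 c1 d1 h]]] := fold _ _ ha hb.
  have [c' [d' [-> s2 c2 d2 h']]] := fold _ _ ha' hb'.
  move/class_pt_inj; rewrite !pt00 !pt10 => /(_ s1 s2 c1 d1 c2 d2) /pt_inj[ec ed].
  by move: h h'; rewrite ec ed; case: ifP => _ [-> ->] [-> ->].
Qed.

(** The chart is the inverse of [dev] on a small ball, a homeomorphism onto its image by continuity,
    openness and injectivity there. *)
Lemma low_rep_chart (v : plane) : low_rep v -> exists U phi,
  [/\ chamanara_atlas R (U, phi), U (dev v) &
      \forall t \near (0 : plane), phi (dev (v + t)) = v + t].
Proof.
move=> lv; have [e e0 he] := low_rep_local lv.
pose B : set plane := ball v e.
have BE q : B q -> exists a b, [/\ `|a| < e, `|b| < e & q = v + pt a b].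
  move=> [_ h]; exists (q 0 0 - v 0 0), (q 1 0 - v 1 0).
  have := h 0 0; have := h 1 0; rewrite /ball /= => h1 h0; split.
  - by rewrite distrC.
  - by rewrite distrC.
  - by rewrite -[LHS]ptK -[RHS]ptK !mxE /= ![_ + (_ - _)]addrC !subrK.
have Bgood q : B q -> dev_good q.
  by move=> /BE[a [b [ha hb ->]]]; exact: (he _ _ ha hb).1.
have Binj q q' : B q -> B q' -> dev q = dev q' -> q = q'.
  move=> /BE[a [b [ha hb ->]]] /BE[a' [b' [ha' hb' ->]]].
  by move=> /((he _ _ ha hb).2 _ _ ha' hb')[-> ->].
have oB : open B by exact: ball_open.
have Bnear q : B q -> \forall t \near (0 : plane), B (q + t).
  by move=> Bq; apply/near_addP; exact: open_nbhs_nbhs.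
pose U : set X := dev @` B.
pose phi (x : X) : plane := xget 0 [set q | B q /\ dev q = x].
have phiE q : B q -> phi (dev q) = q.
  move=> Bq; rewrite /phi; case: xgetP => [q' _ [Bq' e']|/(_ q)]; last by case.
  exact: Binj.
exists U, phi; split; last first.
- by apply: near0S (Bnear v (ballxx _ e0)) => t /phiE.
- by exists v => //; exact: ballxx.
split=> /=.
- split.
  + rewrite openE => _ [q Bq <-]; apply: dev_open_good; first exact: Bgood.
    by apply: near0S (Bnear q Bq) => t ?; exists (q + t).
  + by move=> x y /set_mem[q Bq <-] /set_mem[q' Bq' <-]; rewrite !phiE // => ->.
  + move=> W oW; rewrite openE => _ [[q Bq <-]]; rewrite /= phiE // => Wq.
    apply: dev_open_good; first exact: Bgood.
    have : nbhs q W by exact: open_nbhs_nbhs.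
    move=> /near_addP; apply: near0S2 (Bnear q Bq) => t Bt Wt.
    by split; [exists (q + t) | rewrite /preimage /= phiE].
  + move=> W oW WU; rewrite openE => _ [x Wx <-].
    have [q Bq qx] := WU _ Wx; rewrite -qx phiE //.
    apply/near_addP; have : nbhs (dev q) W by rewrite qx; exact: open_nbhs_nbhs.
    move=> /(dev_continuous_good (Bgood _ Bq)).
    apply: near0S2 (Bnear q Bq) => t Bt Wt.
    by exists (dev (q + t)) => //; rewrite phiE.
(* The representative [q0] in the square may differ from the point [q] of the ball, for instance lie
   on the opposite edge; equality of the two germs of [dev] makes the chart a translation by
   [q - q0] near [q0]. *)
- move=> u [q Bq]; set q0 : plane := set_val u.
  have sq0 : square q0 by exact/set_mem/valP.
  rewrite -class_ptE -dev_square // -/q0 => e1.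
  exists (q - q0).
  have h : \forall t \near (0 : plane), phi (dev (q0 + t)) = q + t.
    have := dev_eq_near_good (Bgood _ Bq) (dev_good_square sq0) e1.
    by apply: near0S2 (Bnear q Bq) => t Bt <-; exact: phiE.
  have {h} : \forall w \near q0, phi (dev w) = w + (q - q0).
    apply/(@near_addP _ q0 (fun w => phi (dev w) = w + (q - q0))).
    by apply: near0S h => t ->; rewrite [RHS]addrC [RHS]addrA subrK.
  move=> /(@initial_continuous _ _ (set_val : set_type square -> plane) u).
  move=> h; apply: (@filterS _ (nbhs u) _ _ _ _ h) => w; rewrite /preimage /= => <-.
  by rewrite -class_ptE dev_square //; exact/set_mem/valP.
Qed.

Lemma square_chart (v : plane) : square v -> exists U phi b,
  [/\ chamanara_atlas R (U, phi), U (dev v) &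
      \forall t \near (0 : plane), phi (dev (v + t)) = v + t + b].
Proof.
move=> sv; have [w [lw vw h]] := low_rep_near sv.
have [U [phi [aU Uw hphi]]] := low_rep_chart lw.
exists U, phi, (w - v); split; [by []|by rewrite vw|].
by move: h hphi; apply: near0S2 => t -> ->; rewrite [v + t]addrC addrACA subrr addr0 addrC.
Qed.

(** Affinity with derivative [M], stated on germs of [dev] instead of charts, so that compositions
    need no matching of chart domains. *)
Definition locally_linear (f : X -> X) (M : 'M[R]_2) : Prop :=
  forall v, square v -> exists2 w, square w &
    \forall t \near (0 : plane), f (dev (v + t)) = dev (w + M *m t).

Lemma locally_linear_low_rep (f : X -> X) (M : 'M[R]_2) :
  (forall v, low_rep v -> exists2 w, square w &
    \forall t \near (0 : plane), f (dev (v + t)) = dev (w + M *m t)) ->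
  locally_linear f M.
Proof.
move=> h v sv; have [u [lu _ vu]] := low_rep_near sv.
have [w sw hw] := h _ lu; exists w => //.
by move: vu hw; apply: near0S2 => t ->.
Qed.

Lemma locally_linear_comp (f g : X -> X) (M N : 'M[R]_2) :
  locally_linear f M -> locally_linear g N -> locally_linear (g \o f) (N *m M).
Proof.
move=> hf hg v /hf[w /hg[u su hu] hw]; exists u => //.
move: hw (near0_mulmx M hu); apply: near0S2 => t /= -> ->.
by rewrite mulmxA.
Qed.

Lemma locally_linear_id : locally_linear id 1%:M.
Proof. by move=> v sv; exists v => //; apply: near0W => t; rewrite mul1mx. Qed.

Lemma locally_linear_continuous (f : X -> X) (M : 'M[R]_2) :
  locally_linear f M -> continuous f.
Proof.
move=> hf x; have [v /low_rep_square sv ->] := low_rep_surj x.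
have [w sw hw] := hf v sv.
have fv : f (dev v) = dev w by have := nbhs_singleton hw; rewrite mulmx0 !addr0.
move=> W; rewrite fv => /(dev_continuous sw) /(near0_mulmx M) nW.
apply: dev_open => //; move: hw nW; apply: near0S2 => t.
by rewrite /preimage /= => ->.
Qed.

Lemma locally_linear_affine (f g : X -> X) (M N : 'M[R]_2) :
  locally_linear f M -> locally_linear g N -> cancel f g -> cancel g f ->
  affine_homeo (chamanara_atlas R) (chamanara_atlas R) M f.
Proof.
move=> hf hg fg gf; split.
  split; first exact: locally_linear_continuous hf.
  by exists g; split => //; exact: locally_linear_continuous hg.
move=> x; have [v /low_rep_square sv ->] := low_rep_surj x.
have [w sw hw] := hf v sv.
have fv : f (dev v) = dev w by have := nbhs_singleton hw; rewrite mulmx0 !addr0.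
have [U [phi [b [aU Uv hphi]]]] := square_chart sv.
have [V [psi [c [aV Vw hpsi]]]] := square_chart sw.
exists U, phi, V, psi; split => //; first by rewrite fv.
(* In the two charts the map sends [v + t + b] to [w + M *m t + c], which forces this constant. *)
exists (w + c - M *m (v + b)); apply: dev_open => //.
move: hw hphi (near0_mulmx M hpsi); apply: filterS3 => t -> -> ->.
have -> : M *m (v + t + b) = M *m (v + b) + M *m t by rewrite addrAC mulmxDr.
have rearrange (p a m q : plane) : p + m + q = a + m + (p + q - a).
  by rewrite [RHS]addrC [RHS]addrA subrK addrAC.
exact: rearrange.
Qed.

End LocalStructure.

(** * The baker map *)

Section Baker.
Context {R : realType}.
Local Notation plane := 'cV[R]_2.
Local Notation X := (chamanara R).
Local Notation shift := (seg_shift R).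
Local Notation square := (@square R).

(** The cut x = 1/2 separates segment 0 from all the others, among low and high segments alike;
    hence the case split on the index below. *)
Lemma low_seg0 (x : R) : low_seg 0 x -> 0 < x < 1/2.
Proof. by rewrite /low_seg halfpowS expr0; lra. Qed.

Lemma low_segS_gt k (x : R) : low_seg k.+1 x -> 1/2 < x.
Proof. by rewrite /low_seg halfpowS; have [] := @halfpow R k; lra. Qed.

Lemma high_seg0 (x : R) : high_seg 0 x = (1/2 < x < 1).
Proof. by rewrite /high_seg halfpowS expr0; apply/idP/idP; lra. Qed.

Lemma high_segS_lt k (x : R) : high_seg k.+1 x -> x < 1/2.
Proof. by rewrite /high_seg [2 ^- k.+1]halfpowS; have [] := @halfpow R k; lra. Qed.

(** Applies [g] to a chosen representative; [lift_ptE] frees it from the choice once [g] respects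
    both kinds of gluing. *)
Definition lift_pt (g : plane -> plane) (x : X) : X :=
  class_pt (g (set_val (generic_quotient.repr (x : gen_quot (@Defs.glue R))))).

Lemma lift_ptE (g : plane -> plane) :
  (forall k y, low_seg k y ->
     class_pt (g (pt 0 y)) = class_pt (g (pt 1 (y + shift k)))) ->
  (forall k x, low_seg k x ->
     class_pt (g (pt x 0)) = class_pt (g (pt (x + shift k) 1))) ->
  forall v, square v -> lift_pt g (class_pt v) = class_pt (g v).
Proof.
move=> hLR hBT v /mem_set sv; rewrite (class_pt_mem sv) /lift_pt.
set u := generic_quotient.repr _.
have : gen_class (@Defs.glue R) u = gen_class (@Defs.glue R) (exist _ v sv).
  by rewrite /gen_class reprK.
move=> /gen_class_eqP h.
suff hr : forall c d, clos_refl_sym_trans _ (@Defs.glue R) c d ->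
    class_pt (g (set_val c)) = class_pt (g (set_val d)) by exact: hr _ _ h.
move=> c d; elim=> [{}c {}d [k [[y hy [-> ->]]|[x hx [-> ->]]]]|//|? ? _ -> //|].
- exact: hLR.
- exact: hBT.
- by move=> ? ? ? _ -> _ ->.
Qed.

(** Vertical and horizontal edges carry the same segments and shifts, so reflection in the diagonal
    descends to X. Its determinant is -1; its use is to conjugate the baker map to its inverse. *)
Definition swap_pt (v : plane) : plane := pt (v 1 0) (v 0 0).

Definition swap : X -> X := lift_pt swap_pt.

Lemma swapE (a b : R) : square (pt a b) -> swap (class_pt (pt a b)) = class_pt (pt b a).
Proof.
move=> sv; rewrite /swap lift_ptE //; first by rewrite /swap_pt pt00 pt10.
- by move=> k y hy; rewrite /swap_pt !pt00 !pt10; exact: class_pt_BT.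
- by move=> k y hy; rewrite /swap_pt !pt00 !pt10; exact: class_pt_LR.
Qed.

Lemma square_swap (a b : R) : square (pt a b) -> square (pt b a).
Proof.
move=> /squareP[[? ?]|[k [? ?]]|[k [? ?]]|[k [[? ?]|[? ?]]]]; apply/squareP.
- exact: Or41.
- by apply: Or44; exists k; left.
- by apply: Or44; exists k; right.
- by apply: Or42; exists k.
- by apply: Or43; exists k.
Qed.

Lemma swapK : involutive swap.
Proof.
move=> x; have [q sq ->] := class_pt_surj x; move: sq; rewrite -(ptK q) => sq.
by rewrite !swapE //; exact: square_swap.
Qed.

Definition swap_mx : 'M[R]_2 := \matrix_(i, j) (i != j)%:R.

Lemma mulmx_swap (a b : R) : swap_mx *m pt a b = pt b a.
Proof. by rewrite mulmx_pt !mxE /= !mul0r !mul1r add0r addr0. Qed.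

Lemma swap_locally_linear : locally_linear swap swap_mx.
Proof.
apply: locally_linear_low_rep => _ [x y hx hy|k y hy|k x hx].
- exists (pt y x); first exact: square_in.
  have := near_interior_square hx hy; move=> /near0_ptP[e e0 he].
  apply/near0_ptP; exists e => // a b ha hb; have := he a b ha hb.
  rewrite mulmx_swap !ptD => sq.
  rewrite !dev_square ?swapE //; exact: square_swap.
- exists (pt y 0); first by apply: (square_low_B _ hy); lra.
  have [e e0 he] := low_seg_near hy.
  apply/near0_ptP; exists (Num.min e (1/2)); first by rewrite lt_min e0; lra.
  move=> a b; rewrite !lt_min => /andP[_ /ltr_normlP[a1 a2]] /andP[/he hb _].
  rewrite mulmx_swap !ptD !add0r.
  have hb' : high_seg k (y + b + shift k) by rewrite high_seg_shift.
  have := low_seg_range hb; have := high_seg_range hb' => ? ?.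
  have [a0|a0] := ltP a 0.
  + by rewrite (dev_L _ hb) // (dev_B _ hb) // swapE //; apply: square_in; lra.
  + by rewrite !dev_in ?swapE //; try lra; apply: (square_low_L _ hb); lra.
- exists (pt 0 x); first by apply: (square_low_L _ hx); lra.
  have [e e0 he] := low_seg_near hx.
  apply/near0_ptP; exists (Num.min e (1/2)); first by rewrite lt_min e0; lra.
  move=> b a; rewrite !lt_min => /andP[/he hb _] /andP[_ /ltr_normlP[a1 a2]].
  rewrite mulmx_swap !ptD !add0r.
  have hb' : high_seg k (x + b + shift k) by rewrite high_seg_shift.
  have := low_seg_range hb; have := high_seg_range hb' => ? ?.
  have [a0|a0] := ltP a 0.
  + by rewrite (dev_L _ hb) // (dev_B _ hb) // swapE //; apply: square_in; lra.
  + by rewrite !dev_in ?swapE //; try lra; apply: (square_low_B _ hb); lra.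
Qed.

(* The left half has to be stacked above the right one: the cut x = 1/2 is then
   reglued by the first pair of vertical segments. *)
Definition baker_pt (v : plane) : plane :=
  if v 0 0 <= 1/2 then pt (2 * v 0 0) (v 1 0 / 2 + 1/2)
  else pt (2 * v 0 0 - 1) (v 1 0 / 2).

Lemma baker_pt_low (a b : R) : a <= 1/2 -> baker_pt (pt a b) = pt (2 * a) (b / 2 + 1/2).
Proof. by rewrite /baker_pt pt00 pt10 => ->. Qed.

Lemma baker_pt_high (a b : R) : 1/2 < a -> baker_pt (pt a b) = pt (2 * a - 1) (b / 2).
Proof. by rewrite /baker_pt pt00 pt10 leNgt => ->. Qed.

Definition baker : X -> X := lift_pt baker_pt.

(** The vertical gluing of index [k] goes to that of index [k.+1], the horizontal one of index
    [k.+1] to that of index [k]. The two horizontal segments of index 0 are sent to the same points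
    of the seam y = 1/2. *)
Lemma bakerE (v : plane) : square v -> baker (class_pt v) = class_pt (baker_pt v).
Proof.
apply: lift_ptE => [k y hy|[|k] x hx].
- rewrite baker_pt_low; last lra.
  rewrite baker_pt_high; last lra.
  rewrite mulr0 (@class_pt_LR _ k.+1); last by rewrite mul1r; exact: low_segS.
  by congr (class_pt (pt _ _)); have := @seg_shiftS R k; lra.
- have := low_seg0 hx; rewrite seg_shift0 => ?.
  rewrite baker_pt_low; last lra.
  rewrite baker_pt_high; last lra.
  by congr (class_pt (pt _ _)); lra.
- have := low_segS_gt hx; have : high_seg k.+1 (x + shift k.+1) by rewrite high_seg_shift.
  move=> /high_segS_lt h1 h2.
  rewrite baker_pt_high // baker_pt_low; last lra.
  rewrite mul0r (@class_pt_BT _ k); last exact: low_segP.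
  by congr (class_pt (pt _ _)); have := @seg_shiftS R k; lra.
Qed.

Lemma g_mx_ln2 (a b : R) : g_mx (ln 2) *m pt a b = pt (2 * a) (b / 2).
Proof.
rewrite mulmx_pt !mxE /= expRN lnK ?posrE //.
by rewrite !mulr1n !mulr0n !mul0r add0r addr0 [b / 2]mulrC.
Qed.

Lemma baker_locally_linear : locally_linear baker (g_mx (ln 2)).
Proof.
apply: locally_linear_low_rep => _ [x y hx hy|k y hy|[|k] x hx].
- have [e e0 he] := (@near0_ptP _ _).1 (near_interior hx hy).
  have [x1|x1|x1] := ltgtP x (1/2).
  + exists (pt (2 * x) (y / 2 + 1/2)); first by apply: square_in; lra.
    apply/near0_ptP; exists (Num.min e (1/2 - x)); first by rewrite lt_min e0; lra.
    move=> a b; rewrite !lt_min => /andP[ha /ltr_normlP[? ?]] /andP[hb _].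
    have [] := he _ _ ha hb; rewrite g_mx_ln2 !ptD !pt00 !pt10 => h1 h2; rewrite dev_in; [|lra|lra].
    rewrite dev_in; [|lra|lra].
    rewrite bakerE; last by apply: square_in; lra.
    by rewrite baker_pt_low; [congr (class_pt (pt _ _)); lra|lra].
  + exists (pt (2 * x - 1) (y / 2)); first by apply: square_in; lra.
    apply/near0_ptP; exists (Num.min e (x - 1/2)); first by rewrite lt_min e0; lra.
    move=> a b; rewrite !lt_min => /andP[ha /ltr_normlP[? ?]] /andP[hb _].
    have [] := he _ _ ha hb; rewrite g_mx_ln2 !ptD !pt00 !pt10 => h1 h2; rewrite dev_in; [|lra|lra].
    rewrite dev_in; [|lra|lra].
    rewrite bakerE; last by apply: square_in; lra.
    by rewrite baker_pt_high; [congr (class_pt (pt _ _)); lra|lra].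
  (* A point of the cut goes to high segment 0 of the right edge. Past that edge [dev] lowers points
     by 1/2, which is where the baker map puts the points right of the cut. *)
  + have hs (b : R) : 0 < b < 1 -> high_seg 0 (b / 2 + 1/2) by rewrite high_seg0; lra.
    exists (pt 1 (y / 2 + 1/2)); first by apply/squareP/Or43; exists 0%N; split=> //; exact: hs.
    apply/near0_ptP; exists e => // a b ha hb.
    have [] := he _ _ ha hb; rewrite g_mx_ln2 !ptD !pt00 !pt10 => h1 h2.
    rewrite dev_in; [|lra|lra]; rewrite bakerE; last by apply: square_in; lra.
    have [a0|a0] := ltP 0 a.
    * rewrite baker_pt_high; last lra.
      rewrite (@dev_R _ 0); [|lra|by rewrite high_seg0; lra].
      by rewrite seg_shift0; congr (class_pt (pt _ _)); lra.
    * rewrite baker_pt_low; last lra.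
      by rewrite dev_in; [congr (class_pt (pt _ _)); lra|lra|lra].
- have hw (b : R) : low_seg k b -> low_seg k.+1 (b / 2 + 1/2).
    by rewrite mul1r; exact: low_segS.
  exists (pt 0 (y / 2 + 1/2)); first by apply: (square_low_L _ (hw _ hy)); lra.
  have [e e0 he] := low_seg_near hy.
  apply/near0_ptP; exists (Num.min e (1/4)); first by rewrite lt_min e0; lra.
  move=> a b; rewrite !lt_min => /andP[_ /ltr_normlP[a1 a2]] /andP[/he hb _].
  rewrite g_mx_ln2 !ptD !add0r.
  have hb' : high_seg k (y + b + shift k) by rewrite high_seg_shift.
  have := low_seg_range hb; have := high_seg_range hb' => ? ?.
  have hwb : low_seg k.+1 (y / 2 + 1 / 2 + b / 2).
    by rewrite (_ : _ + b / 2 = (y + b) / 2 + 1/2); [exact: hw|lra].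
  have [a0|a0] := ltP a 0.
  + rewrite (dev_L _ hb) // bakerE; last by apply: square_in; lra.
    rewrite baker_pt_high; last lra.
    rewrite (dev_L _ hwb); last lra.
    by rewrite seg_shiftS; congr (class_pt (pt _ _)); lra.
  + rewrite dev_in; [|lra|lra]; rewrite bakerE; last by apply: (square_low_L _ hb); lra.
    rewrite baker_pt_low; last lra.
    by rewrite dev_in; [congr (class_pt (pt _ _)); lra|lra|lra].
(* Bottom segment 0 goes to the seam y = 1/2; points below it re-enter at the top of the right half,
   whose image lies under the seam. *)
- have hx0 := low_seg0 hx.
  exists (pt (2 * x) (1/2)); first by apply: square_in; lra.
  have [e e0 he] := low_seg_near hx.
  apply/near0_ptP; exists (Num.min e (1/2)); first by rewrite lt_min e0; lra.
  move=> a b; rewrite !lt_min => /andP[/he ha _] /andP[_ /ltr_normlP[? ?]].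
  rewrite g_mx_ln2 !ptD add0r.
  have := low_seg0 ha => ?.
  have [b0|b0] := ltP b 0.
  + rewrite (dev_B _ ha) // seg_shift0 bakerE; last by apply: square_in; lra.
    rewrite baker_pt_high; last lra.
    by rewrite dev_in; [congr (class_pt (pt _ _)); lra|lra|lra].
  + rewrite dev_in; [|lra|lra]; rewrite bakerE; last by apply: (square_low_B _ ha); lra.
    rewrite baker_pt_low; last lra.
    by rewrite dev_in; [congr (class_pt (pt _ _)); lra|lra|lra].
- exists (pt (2 * x - 1) 0); first by apply: (square_low_B _ (low_segP hx)); lra.
  have [e e0 he] := low_seg_near hx.
  apply/near0_ptP; exists (Num.min e (1/2)); first by rewrite lt_min e0; lra.
  move=> a b; rewrite !lt_min => /andP[/he ha _] /andP[_ /ltr_normlP[? ?]].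
  rewrite g_mx_ln2 !ptD !add0r.
  have := low_segS_gt ha; have ha' : high_seg k.+1 (x + a + shift k.+1) by rewrite high_seg_shift.
  have := high_segS_lt ha'; have := low_seg_range ha; have := high_seg_range ha' => ? ? ? ?.
  have hw : low_seg k (2 * x - 1 + 2 * a).
    by rewrite (_ : _ + 2 * a = 2 * (x + a) - 1); [exact: low_segP|lra].
  have [b0|b0] := ltP b 0.
  + rewrite (dev_B _ ha) // bakerE; last by apply: square_in; lra.
    rewrite baker_pt_low; last lra.
    rewrite (dev_B _ hw); last lra.
    by rewrite seg_shiftS; congr (class_pt (pt _ _)); lra.
  + rewrite dev_in; [|lra|lra]; rewrite bakerE; last by apply: (square_low_B _ ha); lra.
    rewrite baker_pt_high; last lra.
    by rewrite dev_in; [congr (class_pt (pt _ _)); lra|lra|lra].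
Qed.

Lemma baker_pt_square (v : plane) : low_rep v -> square (baker_pt v).
Proof.
case=> [x y hx hy|k y hy|[|k] x hx].
- have [x1|x1|x1] := ltgtP x (1/2).
  + by rewrite baker_pt_low; [apply: square_in; lra|lra].
  + by rewrite baker_pt_high; [apply: square_in; lra|lra].
  + rewrite x1 baker_pt_low //; apply/squareP/Or43; exists 0%N.
    by rewrite high_seg0; split; lra.
- rewrite baker_pt_low; last lra.
  by apply: (@square_low_L _ k.+1); [lra|rewrite mul1r; exact: low_segS].
- by have := low_seg0 hx => ?; rewrite baker_pt_low; [apply: square_in; lra|lra].
- rewrite baker_pt_high; last exact: low_segS_gt hx.
  by apply: (square_low_B _ (low_segP hx)); lra.
Qed.

(* The baker map is inverted by exchanging the roles of the two coordinates. *)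
Definition baker_inv : X -> X := swap \o (baker \o swap).

Lemma bakerK : cancel baker baker_inv.
Proof.
move=> x; have [v lv ->] := low_rep_surj x; have sv := low_rep_square lv.
have sbv := baker_pt_square lv; move: lv sv sbv.
rewrite -(ptK v); move: (v 0 0) (v 1 0) => a b lv sv sbv.
rewrite dev_square // bakerE // /baker_inv /=.
have [/andP[a0 a1] /andP[b0 b1]] := square_range sv.
have [ah|ah] := leP a (1/2).
- rewrite baker_pt_low // in sbv *; rewrite swapE // bakerE; last exact: square_swap.
  (* For [b = 0] the image is on the seam, where the swapped baker map takes its other branch and
     returns (a + 1/2, 1), the partner of (a, 0) in gluing 0. *)
  move: b0; rewrite le_eqVlt => /predU1P[eb|b0].
    have ha : low_seg 0 a.
      move/squareP: sv; rewrite -eb.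
      case=> [[_ ?]|[k [_ /low_seg_range ?]]|[k [_ /high_seg_range ?]]|]; try by exfalso; lra.
      move=> [[|k] [[h e]|[_ e]]] //; try by exfalso; lra.
      by have := low_segS_gt h; lra.
    rewrite -eb baker_pt_low; last lra.
    rewrite (_ : pt _ _ = pt 1 (a + shift 0)); last first.
      by rewrite seg_shift0; congr pt; lra.
    rewrite swapE; last by apply/squareP/Or43; exists 0%N; rewrite high_seg_shift.
    by rewrite -class_pt_BT.
  rewrite baker_pt_high; last lra.
  rewrite (_ : pt _ _ = pt b a); last by congr pt; lra.
  by rewrite swapE //; exact: square_swap.
- rewrite baker_pt_high // in sbv *; rewrite swapE // bakerE; last exact: square_swap.
  rewrite baker_pt_low; last lra.
  rewrite (_ : pt _ _ = pt b a); last by congr pt; lra.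
  by rewrite swapE //; exact: square_swap.
Qed.

(** By [bakerK] the map [swap \o baker] is an involution; conjugating by [swap] gives the other
    side. *)
Lemma baker_invK : cancel baker_inv baker.
Proof. by move=> x; rewrite -{2}(swapK x) -(bakerK (swap x)) /baker_inv /= !swapK. Qed.

Lemma baker_inv_locally_linear :
  locally_linear baker_inv (swap_mx *m (g_mx (ln 2) *m swap_mx)).
Proof.
apply: locally_linear_comp; last exact: swap_locally_linear.
exact: locally_linear_comp swap_locally_linear baker_locally_linear.
Qed.

Lemma g_mxD (s t : R) : g_mx s *m g_mx t = g_mx (s + t).
Proof.
rewrite /g_mx mulmx_diag; congr diag_mx; apply/rowP => j.
by rewrite !mxE; case: ifP => _; rewrite -expRD ?opprD.
Qed.

Lemma g_mx0 : g_mx (0 : R) = 1%:M.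
Proof.
rewrite /g_mx -diag_const_mx; congr diag_mx; apply/rowP => j.
by rewrite !mxE oppr0 expR0 if_same.
Qed.

(** The derivatives enter as a sequence with its recursion, which fits both the closed form
    [g_mx (k%:R * ln 2)] and formal matrix powers. *)
Lemma iter_locally_linear (f : X -> X) (M : nat -> 'M[R]_2) (N : 'M[R]_2) n :
  M 0%N = 1%:M -> (forall k, M k.+1 = N *m M k) ->
  locally_linear f N -> locally_linear (iter n f) (M n).
Proof.
move=> M0 MS hf; elim: n => [|n IH]; first by rewrite M0; exact: locally_linear_id.
by rewrite MS; exact: (locally_linear_comp IH hf).
Qed.

Lemma g_mx_veech n : veech (chamanara_atlas R) (g_mx (n%:R * ln 2)).
Proof.
have iterK (f g : X -> X) : cancel f g -> cancel (iter n f) (iter n g).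
  by move=> fg; elim: n => // m IH x; rewrite iterSr iterS fg IH.
split; first by rewrite /g_mx det_diag big_ord_recl big_ord1 !mxE /= -expRD subrr expR0.
exists (iter n baker).
pose N := swap_mx *m (g_mx (ln 2) *m swap_mx).
apply: (@locally_linear_affine _ _ (iter n baker_inv) _ (iter n (mulmx N) 1%:M)).
- apply: (@iter_locally_linear _ (fun k => g_mx (k%:R * ln 2)) (g_mx (ln 2))).
  + by rewrite mul0r g_mx0.
  + by move=> k; rewrite g_mxD -natr1 mulrDl mul1r addrC.
  + exact: baker_locally_linear.
- apply: (@iter_locally_linear _ (fun k => iter k (mulmx N) 1%:M) N) => //.
  exact: baker_inv_locally_linear.
- exact/iterK/bakerK.
- exact/iterK/baker_invK.
Qed.

End Baker.

(** * Covers and the orbit space *)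

Section Homeomorphisms.
Context {S T U : topologicalType}.

Lemma homeomorphism_comp (f : S -> T) (g : T -> U) :
  homeomorphism f -> homeomorphism g -> homeomorphism (g \o f).
Proof.
move=> [cf [f' [cf' fK f'K]]] [cg [g' [cg' gK g'K]]]; split.
  by move=> x; apply: continuous_comp; [exact: cf|exact: cg].
exists (f' \o g'); split; [|exact: can_comp|exact: can_comp].
by move=> x; apply: continuous_comp; [exact: cg'|exact: cf'].
Qed.

Lemma homeomorphism_id : homeomorphism (@id T).
Proof.
have cid : continuous (@id T) by move=> x; exact: cvg_id.
by split=> //; exists id.
Qed.

Lemma homeomorphism_connected (f : S -> T) :
  homeomorphism f -> connected [set: S] -> connected [set: T].
Proof.
move=> [cf [g [cg fK gK]]] cS.
have -> : [set: T] = f @` [set: S].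
  by apply/seteqP; split => // y _; exists (g y).
by apply: connected_continuous_connected => //; exact: continuous_subspaceT.
Qed.

End Homeomorphisms.

Lemma homeomorphism_connectedE (S T : topologicalType) (f : S -> T) :
  homeomorphism f -> connected [set: S] <-> connected [set: T].
Proof.
move=> hf; split; first exact: homeomorphism_connected hf.
have [cf [g [cg fK gK]]] := hf.
by apply: (@homeomorphism_connected _ _ g); split => //; exists f.
Qed.

(** * Charts and affine maps on covers *)

Section TranslationStructureLemmas.
Context {R : realType}.
Local Notation plane := 'cV[R]_2.

Lemma pullback_homeo (X Y Z : topologicalType) (AX : @atlas R X)
    (p : Y -> X) (q : Z -> X) (h : Y -> Z) (g : Z -> Y) (U : set Y)
    (phi : Y -> plane) :
  continuous h -> continuous g -> cancel h g -> cancel g h -> q \o h = p ->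
  pullback p AX (U, phi) -> pullback q AX (g @^-1` U, phi \o g).
Proof.
move=> ch cg hK gK qh [[/= oU phi_inj phi_cont phi_open]].
move=> [U0 [phi0 [aU0 pU e]]].
have pg z : p (g z) = q z by rewrite -qh /= gK.
split => /=; first split.
- exact: open_comp.
- move=> x y /set_mem gx /set_mem gy /= exy.
  by apply: (can_inj gK); apply: phi_inj => //; exact/mem_set.
- move=> W oW; have := phi_cont W oW.
  by move/(open_comp (f := g) (fun x _ => cg x)).
- move=> W oW WU; rewrite -image_comp; apply: phi_open.
    have -> : g @` W = h @^-1` W.
      apply/seteqP; split => [_ [z Wz <-]|y Wy]; first by rewrite /preimage /= gK.
      by exists (h y).
    by apply: open_comp.
  by move=> _ [z Wz <-]; exact: WU.
- exists U0, phi0; split => //.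
    by move=> _ [z Uz <-]; apply: pU; exists (g z).
  by rewrite e; apply/funext => z /=; rewrite pg.
Qed.

(** Bridges the given cover, whose Veech group is at stake, and its monodromy model, about which
    deviousness speaks. *)
Lemma pullback_affine_conj (X Y Z : topologicalType) (AX : @atlas R X)
    (p : Y -> X) (q : Z -> X) (h : Y -> Z) (f : Y -> Y) (A : 'M[R]_2) :
  homeomorphism h -> q \o h = p ->
  affine_homeo (pullback p AX) (pullback p AX) A f ->
  exists f' : Z -> Z, affine_homeo (pullback q AX) (pullback q AX) A f'.
Proof.
move=> hh qh [hf faff]; have [ch [g [cg hK gK]]] := hh.
have hg : homeomorphism g by split => //; exists h.
exists (h \o (f \o g)); split.
  exact/homeomorphism_comp/hh/homeomorphism_comp/hf.
move=> z; have [U [phi [V [psi [aU Ux aV Vfx [b hb]]]]]] := faff (g z).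
exists (g @^-1` U), (phi \o g), (g @^-1` V), (psi \o g); split => //=.
- exact: pullback_homeo aU.
- exact: pullback_homeo aV.
- by rewrite /preimage /= hK.
- exists b; move: hb => /(cg z); rewrite /= /nbhs /=.
  by apply: filterS => y; rewrite /preimage /= hK.
Qed.

(** A sheet of the covering, cut down to the preimage of a chart domain, is a chart domain. Without
    a chart at each point even the identity would fail [affine_homeo]. *)
Lemma pullback_chart (X Y : topologicalType) (AX : @atlas R X) (p : Y -> X) :
  (forall U phi, AX (U, phi) -> is_chart U phi) ->
  (forall x, exists U phi, AX (U, phi) /\ U x) ->
  covering_map p ->
  forall y, exists U phi, pullback p AX (U, phi) /\ U y.
Proof.
move=> chX covX [cp cov] y.
have [U [oU Uy [F [Fopen _ pU Fhomeo]]]] := cov (p y).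
have [V FV Vy] : (\bigcup_(V in F) V) y by rewrite -pU.
have [pinj _ popen] := Fhomeo V FV.
have [U0 [phi0 [aU0 U0y]]] := covX (p y).
have [oU0 inj0 cont0 open0] := chX _ _ aU0.
have oV := Fopen _ FV.
have opre W : open W -> open (p @^-1` W) by move=> oW; exact: open_comp.
exists (V `&` p @^-1` U0), (phi0 \o p); split => //; split => /=.
- split.
  + by apply: openI => //; exact: opre.
  + move=> a b /set_mem[Va Ua] /set_mem[Vb Ub] /= e.
    by apply: pinj; rewrite ?inE //; apply: inj0; rewrite ?inE.
  + move=> W oW; rewrite -setIA; apply: openI => //.
    exact: opre (cont0 W oW).
  + move=> W oW WV; rewrite -image_comp; apply: open0.
      by apply: popen => // z /WV[].
    by move=> _ [z /WV[_ ?] <-].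
- exists U0, phi0; split => //; move=> _ [z [_ ?] <-] //.
Qed.

Lemma affine_homeo_id (S : topologicalType) (AS : @atlas R S) :
  (forall x, exists U phi, AS (U, phi) /\ U x) -> affine_homeo AS AS 1%:M id.
Proof.
move=> cov; split; first exact: homeomorphism_id.
move=> x; have [U [phi [aU Ux]]] := cov x.
exists U, phi, U, phi; split => //; exists 0.
by apply: filterE => y; rewrite mul1mx addr0.
Qed.

(** Multiplying [psi (f y) = B *m phi y + b] by [A] shows that [f] itself is the translation. *)
Lemma mx_act_translation_equivalent (S : topologicalType) (AS : @atlas R S)
    (A B : 'M[R]_2) (f : S -> S) :
  affine_homeo AS AS B f ->
  translation_equivalent (mx_act (A *m B) AS) (mx_act A AS).
Proof.
move=> [hf faff]; exists f; split => // x.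
have [U [phi [V [psi [aU Ux aV Vfx [b hb]]]]]] := faff x.
exists U, (fun y => (A *m B) *m phi y), V, (fun y => A *m psi y); split => //.
- by exists phi.
- by exists psi.
- exists (A *m b); move: hb; apply: filterS => y ->.
  by rewrite mul1mx mulmxDr mulmxA.
Qed.

End TranslationStructureLemmas.

(** * Returning Teichmueller orbits *)

Section Returning.
Context {R : realType} {X : topologicalType} (AX : @atlas R X) (x0 : X).
Context {n : nat} (G : {group 'S_n}).

Lemma Cov_class_connected (rho rho' : HomG R x0 G) :
  Cov_class rho = Cov_class rho' ->
  connected [set: mcover (set_val rho)] <-> connected [set: mcover (set_val rho')].
Proof.
move=> /gen_class_eqP; elim=> [a b [h hh _]|a|a b _ IH|a b c _ IH1 _ IH2].
- exact: homeomorphism_connectedE hh.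
- by [].
- exact: iff_sym.
- exact: iff_trans IH1 IH2.
Qed.

Lemma orbit_pt_connected A B (rho rho' : HomG R x0 G) :
  orbit_pt AX A (Cov_class rho) = orbit_pt AX B (Cov_class rho') ->
  connected [set: mcover (set_val rho)] <-> connected [set: mcover (set_val rho')].
Proof.
move=> /gen_class_eqP h.
(* A link of the chain carries only a class in [Cov], so the invariant quantifies over the
   homomorphisms representing it. *)
have conn : forall a b, clos_refl_sym_trans _ (@orbit_rel R X AX x0 n G) a b ->
  (exists2 rho, a.2 = Cov_class rho & connected [set: mcover (set_val rho)]) <->
  (exists2 rho, b.2 = Cov_class rho & connected [set: mcover (set_val rho)]).
  move=> a b; elim=> [{}a {}b [s [s' [ea eb [f [hf _]]]]]|//|? ? _|? ? ? _ h1 _ h2].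
  - have := homeomorphism_connectedE hf => hc; split => [] [s1 e1 c1].
    + exists s' => //; apply/hc; apply/(Cov_class_connected _).1: c1.
      by rewrite -e1.
    + exists s => //; apply/hc; apply/(Cov_class_connected _).1: c1.
      by rewrite -e1.
  - exact: iff_sym.
  - exact: iff_trans h1 h2.
have := conn _ _ h => /= {}conn; split => c.
- have [|s1 e1 c1] := conn.1; first by exists rho.
  by apply/(Cov_class_connected _).1: c1.
- have [|s1 e1 c1] := conn.2; first by exists rho'.
  by apply/(Cov_class_connected _).1: c1.
Qed.

(** Since [g_mx (t + c) *m g_mx (- c) = g_mx t], the exponent [- c] gives a translation from time
    [t] to time [t + c]. *)
Lemma g_flow_step (rho : HomG R x0 G) (c t : R) :
  veech (@mcover_atlas R X AX x0 n (set_val rho)) (g_mx (- c)) ->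
  orbit_pt AX (g_flow t) (Cov_class rho) =
  orbit_pt AX (g_flow (t + c)) (Cov_class rho).
Proof.
move=> [_ [f hf]]; apply/gen_class_eqP/rst_step; exists rho, rho; split => //=.
have := mx_act_translation_equivalent (g_mx (t + c)) hf.
by rewrite g_mxD addrK.
Qed.

Lemma devious_no_return {Y : topologicalType} (p : Y -> X) (c : R) :
  devious AX x0 G p -> 0 < c -> ~ veech (pullback p AX) (g_mx (- c)).
Proof.
move=> [cY [rho [[h hh qh] acc]]] c0 [dc [f hf]].
have [f' hf'] := pullback_affine_conj hh qh hf.
have vc : veech (@mcover_atlas R X AX x0 n (set_val rho)) (g_mx (- c)) by split => //; exists f'.
have ret k : orbit_pt AX (g_flow 0) (Cov_class rho) =
    orbit_pt AX (g_flow (k%:R * c)) (Cov_class rho).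
  elim: k => [|k ->]; first by rewrite mul0r.
  by rewrite (g_flow_step _ vc) -[k.+1%:R]natr1 mulrDl mul1r.
(* The starting point recurs at all times [k%:R * c], hence beyond any bound [M], and it lies in
   each of its own neighbourhoods. *)
have [|A [rho' [e]]] := acc (orbit_pt AX (g_flow 0) (Cov_class rho)).
  move=> P Q [M [Mr MP]] /nbhs_singleton Qz.
  have [k hk] : exists k : nat, M < k%:R * c.
    exists (Num.truncn (`|M| / c)).+1.
    have := truncnS_gt (`|M| / c); rewrite ltr_pdivrMr //.
    exact: le_lt_trans (ler_norm _).
  exists (orbit_pt AX (g_flow 0) (Cov_class rho)); split => //.
  by rewrite (ret k); exact: MP.
apply; apply/(orbit_pt_connected e)/(homeomorphism_connectedE hh).1/cY.
Qed.

End Returning.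

Lemma chamanara_charts (R : realType) (x : chamanara R) :
  exists U phi, chamanara_atlas R (U, phi) /\ U x.
Proof.
have [v lv ->] := low_rep_surj x; have [U [phi [aU Uv _]]] := low_rep_chart lv.
by exists U, phi.
Qed.

Theorem mainTheorem4 (R : realType) (Y : topologicalType)
    (p : Y -> chamanara R) :
  devious_finite_abelian_cover
    (chamanara_atlas R) (chamanara_center R) p ->
  infinite_index
    (veech (pullback p (chamanara_atlas R)))
    (veech (chamanara_atlas R)).
Proof.
move=> [[cov _ _ _ _] [n [l [G [_ _ dev_p]]]]].
set H := veech _; set K := veech _.
(* With the identity in [H], each power of the baker derivative lies in its own coset. *)
have H1 : H 1%:M.
  split; first exact: det1.
  exists id; apply/affine_homeo_id/pullback_chart => //; last exact: chamanara_charts.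
  by move=> U phi [].
pose f (i : nat) : set 'M[R]_2 := [set g_mx (i%:R * ln 2) *m B | B in H].
have f_neq i j : (i < j)%N -> f i <> f j.
  move=> ij e; have : f i (g_mx (i%:R * ln 2)) by exists 1%:M => //; rewrite mulmx1.
  rewrite e => -[B HB eB].
  (* Solved from [g_mx (j%:R * ln 2) *m B = g_mx (i%:R * ln 2)]; since [i < j], the exponent is
     negative, as [devious_no_return] demands. *)
  have BE : B = g_mx (- ((j%:R - i%:R) * ln 2)).
    rewrite -[B]mul1mx -g_mx0 -(addNr (j%:R * ln 2)) -g_mxD -mulmxA eB g_mxD.
    by congr g_mx; lra.
  apply: (devious_no_return dev_p) (_ : H (g_mx (- ((j%:R - i%:R) * ln 2)))).
    by rewrite mulr_gt0 ?ln_gt0 ?ltr1n // subr_gt0 ltr_nat.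
  by rewrite -BE.
have f_inj : injective f.
  by move=> i j e; have [/f_neq|/f_neq|] := ltngtP i j => // /(_ (esym e)).
move=> fin; apply: infinite_nat.
have -> : [set: nat] = f @^-1` [set C | exists2 A, K A & C = [set A *m B | B in H]].
  apply/seteqP; split => // i _; exists (g_mx (i%:R * ln 2)) => //.
  exact: g_mx_veech.
by apply: finite_preimage => // ? ? _ _; exact: f_inj.
Qed.
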